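(* Let $L$ satisfy the standing assumptions on inexact smoothness functions, let $N\ge1$, $D>0$, and suppose $d\ge N+2$. Let $W\in\mathbb{R}^{N\times N}$ be lower triangular with $W_{i,i-1}\neq0$ for all $i=1,\dots,N$. Then strong duality holds, $p_{\mathrm{gram}}=d_{\mathrm{gram}}$. Moreover, $$p_{\mathrm{gram}}^{c_L}=d_{\mathrm{gram}}^{c_L}=p_{\mathrm{interp}}^{c_L}\le p_{\mathrm{true}}\le p_{\mathrm{interp}}=p_{\mathrm{gram}}=d_{\mathrm{gram}}.$$
   Context: Norms are Euclidean; $1/\infty=0$. Standing assumptions on $L:[0,\infty)\to(0,\infty]$: finite for all $\delta>0$, convex, lower semicontinuous, nonincreasing, with $-1/L(\cdot)$ convex. A closed, convex, proper $f:\mathbb{R}^d\to(-\infty,\infty]$ is $L(\cdot)$-inexactly smooth if $f(y)\le f(x)+\langle g_x,y-x\rangle+\frac{L(\delta)}{2}\|y-x\|^2+\delta$ for all $x,y\in\mathbb{R}^d$, $g_x\in\partial f(x)$, $\delta\ge0$ (nothing is imposed when $L(\delta)=\infty$). Let $\theta_L(s)=\inf_{\delta\ge0}\{\frac{L(\delta)}2s^2+\delta\}$; its conjugate is $\theta_L^*(u)=\sup_{\delta\ge0}\{\frac{1}{2L(\delta)}u^2-\delta\}$. The self-smoothness constant is $c_L=\inf\{c>0:\theta_L\text{ is }c\,L(\cdot/c)\text{-inexactly smooth}\}$. Rows of $W$ are indexed by $n=1,\dots,N$ and columns by $i=0,\dots,N-1$; lower triangular means only the entries $W_{n,i}$ with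 $i\le n-1$ may be nonzero. $W$ encodes the fixed-step first-order method $$x_n=x_0-\sum_{i=0}^{n-1}W_{n,i}g_i\quad(n=1,\dots,N),\qquad g_i\in\partial f(x_i).\qquad(\ast)$$ Let $\mathcal{I}_N^\star=\{0,1,\dots,N,\star\}$. All ''max'' values below are suprema in $[-\infty,\infty]$. - $p_{\mathrm{true}}$: supremum of $f(x_N)-f(x_\star)$ over all convex $L(\cdot)$-inexactly smooth $f$ on $\mathbb{R}^d$ minimized at a point $x_\star$, all $x_0\in\mathbb{R}^d$ with $\|x_0-x_\star\|^2\le D^2$, and all sequences generated by $(\ast)$ (any choice of subgradients). - $p_{\mathrm{interp}}$: supremum of $f_N-f_\star$ over all $(x_i,f_i,g_i)_{i\in\mathcal{I}_N^\star}\in(\mathbb{R}^d\times\mathbb{R}\times\mathbb{R}^d)^{N+2}$ with $x_n=x_0-\sum_{i=0}^{n-1}W_{n,i}g_i$ for $n=1,\dots,N$, $g_\star=0$, $\mathcal{D}:=D^2-\|x_0-x_\star\|^2\ge0$ and, for all $i,j\in\mathcal{I}_N^\star$, $$\mathcal{Q}_{i,j}:=f_i-f_j-\langle g_j,x_i-x_j\rangle-\theta_L^*(\|g_i-g_j\|)\ge0.$$ - $p_{\mathrm{gram}}$: the Gram-matrix reformulation. Let $F=(f_\star,f_0,\dots,f_N)\in\mathbb{R}^{N+2}$ and let $G$ be a symmetric $(N+2)\times(N+2)$ matrix, representing $P^TP$ with $P=[x_0-x_\star\,|\,g_0\,|\cdots|\,g_N]$. With $e_x,e_0,\dots,e_N$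 the standard basis of $\mathbb{R}^{N+2}$ in this order, put $\mathbf{g}_i=e_i$, $\mathbf{g}_\star=0$, $\mathbf{x}_\star=0$, $\mathbf{x}_0=e_x$, $\mathbf{x}_n=e_x-\sum_{i=0}^{n-1}W_{n,i}e_i$, and define $$\mathcal{D}(F,G)=D^2-e_x^TGe_x,\qquad \mathcal{Q}_{i,j}(F,G)=f_i-f_j-\mathbf{g}_j^TG(\mathbf{x}_i-\mathbf{x}_j)-q_L\big((\mathbf{g}_i-\mathbf{g}_j)^TG(\mathbf{g}_i-\mathbf{g}_j)\big),$$ where $q_L(u)=\sup_{\delta\ge0}\{\frac{u}{2L(\delta)}-\delta\}$, i.e. $q_L(u)=\theta_L^*(\sqrt u)$ for $u\ge0$. Then $p_{\mathrm{gram}}=\sup\{f_N-f_\star:\mathcal{D}(F,G)\ge0,\ \mathcal{Q}_{i,j}(F,G)\ge0\ \forall i,j\in\mathcal{I}_N^\star,\ G\succeq0\}$, a convex program. - $d_{\mathrm{gram}}$: its Lagrange dual value, $$d_{\mathrm{gram}}=\inf_{\nu\ge0,\ \lambda_{i,j}\ge0,\ Z\succeq0}\ \sup_{F,G}\Big\{f_N-f_\star+\nu\,\mathcal{D}(F,G)+\sum_{i,j\in\mathcal{I}_N^\star}\lambda_{i,j}\mathcal{Q}_{i,j}(F,G)+\operatorname{tr}(ZG)\Big\},$$ the supremum being over $F\in\mathbb{R}^{N+2}$ and symmetric $G$ for which all $\mathcal{Q}_{i,j}(F,G)$ are finite. - $p_{\mathrm{interp}}^{c_L},p_{\mathrm{gram}}^{c_L},d_{\mathrm{gram}}^{c_L}$: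 the same three quantities with $L$ replaced in the constraints $\mathcal{Q}_{i,j}$ by $\delta\mapsto L(c_L\delta)/c_L$ (i.e. $\theta_L^*$ replaced by $\theta^*_{L(c_L\cdot)/c_L}$ and $q_L$ by $q_{L(c_L\cdot)/c_L}$). *)

(* Defs.v *)
From HB Require Import structures.
From mathcomp Require Import all_boot all_order all_algebra.
From mathcomp Require Import all_classical all_reals all_analysis.
From mathcomp Require Import ring lra.

Set Implicit Arguments.
Unset Strict Implicit.
Unset Printing Implicit Defensive.

Import Order.TTheory GRing.Theory Num.Theory.
Import numFieldNormedType.Exports.

Local Open Scope classical_set_scope.
Local Open Scope ring_scope.

(* The library's norm on 'rV[R]_d is the sup norm, hence the explicit Euclidean
   one. Both induce the same topology. *)
Definition dotp (R : realType) (d : nat) (u v : 'rV[R]_d) : R := (u *m v^T) 0 0.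

Definition enorm (R : realType) (d : nat) (u : 'rV[R]_d) : R :=
  Num.sqrt (dotp u u).

(* The library's convex_function covers only real-valued functions. Below, f does
   not take the value -oo on A, so no +oo - oo occurs in the right-hand side. *)
Definition econvex (R : realType) (V : lmodType R) (A : set V) (f : V -> \bar R)
    : Prop :=
  forall (x y : V) (t : R), A x -> A y -> 0 <= t <= 1 ->
    (f (t *: x + (1 - t) *: y)%R <= t%:E * f x + (1 - t)%:E * f y)%E.

(* Functions on [0, +oo[ are represented by functions on R whose values at
   negative arguments are never used. In \bar R, (+oo)^-1 = 0 and, in the
   subspace topology, semicontinuity is only required on [0, +oo[. *)
Record inexact_smoothness_function (R : realType) (L : R -> \bar R) : Prop := {
  isf_gt0 : forall delta : R, 0 <= delta -> (0 < L delta)%E ;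
  isf_fin : forall delta : R, 0 < delta -> (L delta < +oo)%E ;
  isf_convex : econvex (V := R^o) `[0, +oo[ L ;
  isf_lsc : lower_semicontinuous (L : subspace `[(0 : R), +oo[ -> \bar R) ;
  isf_noninc : forall delta1 delta2 : R, 0 <= delta1 -> delta1 <= delta2 ->
    (L delta2 <= L delta1)%E ;
  isf_convexV : econvex (V := R^o) `[0, +oo[ (fun delta => - (L delta)^-1)%E
}.

Definition proper (R : realType) (d : nat) (f : 'rV[R]_d -> \bar R) : Prop :=
  (forall x, -oo < f x)%E /\ (exists x, f x < +oo)%E.

Definition subgradient (R : realType) (d : nat) (f : 'rV[R]_d -> \bar R)
    (x g : 'rV[R]_d) : Prop :=
  f x \is a fin_num /\ forall z, (f x + (dotp g (z - x))%:E <= f z)%E.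

(* If L delta = +oo, the inequality holds trivially (+oo * 0 = 0 when y = x). *)
Definition inexactly_smooth (R : realType) (d : nat) (L : R -> \bar R)
    (f : 'rV[R]_d -> \bar R) : Prop :=
  [/\ lower_semicontinuous f, econvex setT f, proper f &
    forall (x y g : 'rV[R]_d) (delta : R), subgradient f x g -> 0 <= delta ->
      (f y <= f x + (dotp g (y - x))%:E
              + L delta * (enorm (y - x) ^+ 2 / 2)%:E + delta%:E)%E].

Definition theta (R : realType) (L : R -> \bar R) (s : R) : \bar R :=
  ereal_inf [set (L delta * (s ^+ 2 / 2)%:E + delta%:E)%E
            | delta in `[(0 : R), +oo[].

Definition conjugate (R : realType) (h : R -> \bar R) (u : R) : \bar R :=
  ereal_sup [set ((u * s)%:E - h s)%E | s in [set: R]].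

Definition theta_conj (R : realType) (L : R -> \bar R) : R -> \bar R :=
  conjugate (theta L).

Definition q_conj (R : realType) (L : R -> \bar R) (u : R) : \bar R :=
  ereal_sup [set ((u / 2)%:E / L delta - delta%:E)%E
            | delta in `[(0 : R), +oo[].

Lemma theta_conjE (R : realType) (L : R -> \bar R) (u : R) :
  (forall delta : R, 0 <= delta -> (0 < L delta)%E) ->
  theta_conj L u = q_conj L (u ^+ 2).
Proof.
move=> L0; apply/eqP; rewrite eq_le; apply/andP; split.
- apply: ge_ereal_sup => _ [s _ <-].
  have q0 : (0 <= q_conj L (u ^+ 2))%E.
    apply: (@le_trans _ _ ((u ^+ 2 / 2)%:E / L 0%R - 0%:E)%E); last first.
      by apply: ereal_sup_ubound; exists 0 => //=; rewrite in_itv/= lexx.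
    rewrite sube0 mule_ge0 ?lee_fin ?divr_ge0 ?sqr_ge0//.
    by rewrite inve_ge0 ltW// L0.
  move: q0; case q_eq : (q_conj L (u ^+ 2)) => [q| |] // q0; last exact: leey.
  have : ((u * s)%:E - q%:E <= theta L s)%E.
    apply: le_ereal_inf_tmp => y [delta /=]; rewrite in_itv/= andbT => d0 <- {y}.
    have := L0 _ d0.
    have : ((u ^+ 2 / 2)%:E / L delta - delta%:E <= q%:E)%E.
      rewrite -q_eq; apply: ereal_sup_ubound; exists delta => //=.
      by rewrite in_itv/= d0.
    case: (L delta) => [l| |]//.
    + rewrite lte_fin => + l0; rewrite inver gt_eqF// -!(EFinM,EFinB,EFinD) !lee_fin => h.
      have -> : l * (s ^+ 2 / 2) + delta
        = u * s - (u ^+ 2 / 2 * l^-1 - delta) + (u - l * s) ^+ 2 / (2 * l).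
        by field; rewrite gt_eqF.
      apply: (@le_trans _ _ (u * s - (u ^+ 2 / 2 / l - delta))); first lra.
      by rewrite lerDl divr_ge0 ?sqr_ge0// mulr_ge0// ltW.
    + rewrite invey mule0 sub0e => + _.
      rewrite -EFinN lee_fin => h.
      have [->|s0] := eqVneq s 0.
        by rewrite expr0n/= mul0r mule0 add0e -EFinB lee_fin; lra.
      by rewrite gt0_mulye ?leey// lte_fin divr_gt0// exprn_even_gt0.
  case: (theta L s) => [t| |]//; last by rewrite leNye.
  by rewrite -!EFinB !lee_fin => h; lra.
- apply: ge_ereal_sup => y [delta /=]; rewrite in_itv/= andbT => d0 <- {y}.
  have key s : (((u * s)%:E - (L delta * (s ^+ 2 / 2)%:E + delta%:E)
      <= theta_conj L u))%E.
    apply: (@le_trans _ _ ((u * s)%:E - theta L s)%E); last first.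
      by apply: ereal_sup_ubound; exists s.
    apply: leeB => //; apply: ereal_inf_lbound; exists delta => //=.
    by rewrite in_itv/= d0.
  have := L0 _ d0; case Ld : (L delta) => [l| |]// l0.
  + apply: le_trans (key (u / l)); rewrite Ld inver gt_eqF//.
    rewrite -!(EFinM,EFinB,EFinD) lee_fin le_eqVlt; apply/orP; left; apply/eqP.
    by field; rewrite gt_eqF.
  + apply: le_trans (key 0); rewrite Ld invey mule0 expr0n/= mul0r mule0 mulr0.
    by rewrite !add0e.
Qed.

(* For an inexact smoothness function L the set is nonempty and bounded below
   by 1 (take x = 0, g = 0), so this is a genuine infimum and c_L >= 1. The scalar
   function theta L is even, and is seen here as a function on R^1. *)
Definition self_smoothness (R : realType) (L : R -> \bar R) : R :=
  inf [set c : R | 0 < c /\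
    inexactly_smooth (fun delta => c%:E * L (delta / c)%R)%E
      (fun s : 'rV[R]_1 => theta L (s 0 0))].

Definition self_scaled (R : realType) (L : R -> \bar R) : R -> \bar R :=
  let c := self_smoothness L in fun delta => (L (c * delta)%R / c%:E)%E.

(* {0, ..., N, star}, with None for star. *)
Notation star_index N := (option 'I_N.+1).

(* W_{n,i} with n = 1, ..., N is the entry W (n - 1) i, so that the sum over
   i <= n - 1 below ranges over the lower triangle, diagonal included. For
   n >= 1, unlift ord0 n is Some (n - 1). *)
Definition iterate (R : realType) (N : nat) (W : 'M[R]_N) (V : lmodType R)
    (x0 : V) (g : 'I_N.+1 -> V) (n : 'I_N.+1) : V :=
  if unlift ord0 n is Some m then
    x0 - \sum_(i < N | (i <= m)%N) W m i *: g (widen_ord (leqnSn N) i)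
  else x0.

(* Only the values g_0, ..., g_{N-1} matter here. *)
Definition p_true (R : realType) (d N : nat) (D : R) (W : 'M[R]_N)
    (L : R -> \bar R) : \bar R :=
  ereal_sup [set v | exists (f : 'rV[R]_d -> \bar R) (xs : 'rV[R]_d)
      (x g : 'I_N.+1 -> 'rV[R]_d),
    [/\ inexactly_smooth L f,
        (forall y, f xs <= f y)%E,
        enorm (x ord0 - xs) ^+ 2 <= D ^+ 2,
        (forall i : 'I_N.+1, (i < N)%N -> subgradient f (x i) (g i)) &
        (forall n : 'I_N.+1, x n = iterate W (x ord0) g n)] /\
    v = (f (x ord_max) - f xs)%E].

Definition Q_interp (R : realType) (d N : nat) (L : R -> \bar R)
    (x : star_index N -> 'rV[R]_d) (f : star_index N -> R)
    (g : star_index N -> 'rV[R]_d) (i j : star_index N) : \bar R :=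
  ((f i - f j - dotp (g j) (x i - x j))%:E - theta_conj L (enorm (g i - g j)))%E.

Definition p_interp (R : realType) (d N : nat) (D : R) (W : 'M[R]_N)
    (L : R -> \bar R) : \bar R :=
  ereal_sup [set v | exists (x : star_index N -> 'rV[R]_d)
      (f : star_index N -> R) (g : star_index N -> 'rV[R]_d),
    [/\ (forall n : 'I_N.+1,
           x (Some n) = iterate W (x (Some ord0)) (fun i => g (Some i)) n),
        g None = 0,
        0 <= D ^+ 2 - enorm (x (Some ord0) - x None) ^+ 2 &
        (forall i j, 0 <= Q_interp L x f g i j)%E] /\
    v = (f (Some ord_max) - f None)%:E].

Definition bform (R : realType) (n : nat) (G : 'M[R]_n) (u v : 'cV[R]_n) : R :=
  (u^T *m G *m v) 0 0.

Definition psd (R : realType) (n : nat) (A : 'M[R]_n) : Prop :=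
  A^T = A /\ forall v : 'cV[R]_n, 0 <= bform A v v.

(* Coordinates of R^(N+2) are ordered as x, 0, ..., N. *)
Definition e_x (R : realType) (N : nat) : 'cV[R]_N.+2 := delta_mx ord0 0.

Definition e_g (R : realType) (N : nat) (i : 'I_N.+1) : 'cV[R]_N.+2 :=
  delta_mx (lift ord0 i) 0.

Definition gvec (R : realType) (N : nat) (i : star_index N) : 'cV[R]_N.+2 :=
  if i is Some k then e_g R k else 0.

Definition xvec (R : realType) (N : nat) (W : 'M[R]_N) (i : star_index N)
    : 'cV[R]_N.+2 :=
  if i is Some n then iterate W (e_x R N) (@e_g R N) n else 0.

Definition D_gram (R : realType) (N : nat) (D : R) (G : 'M[R]_N.+2) : R :=
  D ^+ 2 - bform G (e_x R N) (e_x R N).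

Definition Q_gram (R : realType) (N : nat) (W : 'M[R]_N) (L : R -> \bar R)
    (F : star_index N -> R) (G : 'M[R]_N.+2) (i j : star_index N) : \bar R :=
  ((F i - F j - bform G (gvec R j) (xvec W i - xvec W j))%:E
   - q_conj L (bform G (gvec R i - gvec R j) (gvec R i - gvec R j)))%E.

Definition p_gram (R : realType) (N : nat) (D : R) (W : 'M[R]_N)
    (L : R -> \bar R) : \bar R :=
  ereal_sup [set v | exists (F : star_index N -> R) (G : 'M[R]_N.+2),
    [/\ 0 <= D_gram D G, (forall i j, 0 <= Q_gram W L F G i j)%E & psd G] /\
    v = (F (Some ord_max) - F None)%:E].

Definition lagrangian (R : realType) (N : nat) (D : R) (W : 'M[R]_N)
    (L : R -> \bar R) (nu : R) (lambda : star_index N -> star_index N -> R)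
    (Z : 'M[R]_N.+2) (F : star_index N -> R) (G : 'M[R]_N.+2) : \bar R :=
  ((F (Some ord_max) - F None)%:E + (nu * D_gram D G)%:E
   + \sum_(i : star_index N) \sum_(j : star_index N)
       (lambda i j)%:E * Q_gram W L F G i j
   + (\tr (Z *m G))%:E)%E.

Definition dual_function (R : realType) (N : nat) (D : R) (W : 'M[R]_N)
    (L : R -> \bar R) (nu : R) (lambda : star_index N -> star_index N -> R)
    (Z : 'M[R]_N.+2) : \bar R :=
  ereal_sup [set v | exists (F : star_index N -> R) (G : 'M[R]_N.+2),
    [/\ G^T = G, (forall i j, Q_gram W L F G i j \is a fin_num) &
        v = lagrangian D W L nu lambda Z F G]].

Definition d_gram (R : realType) (N : nat) (D : R) (W : 'M[R]_N)
    (L : R -> \bar R) : \bar R :=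
  ereal_inf [set v | exists (nu : R) (lambda : star_index N -> star_index N -> R)
      (Z : 'M[R]_N.+2),
    [/\ 0 <= nu, (forall i j, 0 <= lambda i j), psd Z &
        v = dual_function D W L nu lambda Z]].

(* Main.v *)
Require Import Defs.
From HB Require Import structures.
From mathcomp Require Import all_boot all_order all_algebra.
From mathcomp Require Import all_classical all_reals all_analysis.
From mathcomp Require Import ring lra.

Set Implicit Arguments.
Unset Strict Implicit.
Unset Printing Implicit Defensive.

Import Order.TTheory GRing.Theory Num.Theory.
Import numFieldNormedType.Exports.

Local Open Scope classical_set_scope.
Local Open Scope ring_scope.

(* Upper bound.  Evaluating the defining inequality of an L-inexactly smooth f at
   x - (g_x - g_y) / L(delta) gives the conditions Q_(i,j) >= 0; the only missing
   subgradient, at x_N, exists by Hahn-Banach in R^d.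

   Lower bound.  theta(s) = inf_delta (L(delta) s^2 / 2 + delta) is convex, since
   1 / L is concave, and s |-> theta(s) / s^2 is nonincreasing for s > 0, whence
   theta(t) <= theta(s) + k (t - s) + 6 theta(t - s) for every slope k at s: the
   self-smoothness constant c is finite, and the infimum defining it is attained.
   So Th := theta / c satisfies Th(t) <= Th(s) + k (t - s) + theta(t - s), and
   data satisfying the scaled conditions are interpolated by the supremum of the
   common affine minorants of the functions
   f_i + <g_i, . - x_i> + Th(|. - x_i|), which is L-inexactly smooth.

   Duality.  The value of the perturbed Gram program is concave and, by Slater's
   condition, finite near 0, so it has a supergradient there: the multipliers.
   The Slater point is the Gram matrix of the method run on a quadratic with
   small distinct curvatures.  As W_(i,i-1) <> 0, its gradients are obtained from
   x_0 by polynomials of exact degrees 1, ..., N + 1, hence are independent. *)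

(** * Euclidean geometry and supporting functionals *)

Section Dotp.
Context {R : realType} {d : nat}.
Implicit Types u v w : 'rV[R]_d.

Lemma dotpE u v : dotp u v = \sum_i u 0 i * v 0 i.
Proof. by rewrite /dotp mxE; apply: eq_bigr => i _; rewrite mxE. Qed.

Lemma dotpC u v : dotp u v = dotp v u.
Proof. by rewrite !dotpE; apply: eq_bigr => i _; rewrite mulrC. Qed.

Lemma dotpDl u v w : dotp (u + v) w = dotp u w + dotp v w.
Proof. by rewrite /dotp mulmxDl mxE. Qed.

Lemma dotpZl a u w : dotp (a *: u) w = a * dotp u w.
Proof. by rewrite /dotp -scalemxAl mxE. Qed.

Lemma dotpNl u w : dotp (- u) w = - dotp u w.
Proof. by rewrite -scaleN1r dotpZl mulN1r. Qed.

Lemma dotp0l w : dotp 0 w = 0.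
Proof. by rewrite -(scale0r w) dotpZl mul0r. Qed.

Lemma dotpDr u v w : dotp w (u + v) = dotp w u + dotp w v.
Proof. by rewrite ![dotp w _]dotpC dotpDl. Qed.

Lemma dotpZr a u w : dotp w (a *: u) = a * dotp w u.
Proof. by rewrite ![dotp w _]dotpC dotpZl. Qed.

Lemma dotpNr u w : dotp w (- u) = - dotp w u.
Proof. by rewrite ![dotp w _]dotpC dotpNl. Qed.

Lemma dotp0r w : dotp w 0 = 0.
Proof. by rewrite dotpC dotp0l. Qed.

Definition dotp_lin :=
  (dotpDl, dotpDr, dotpNl, dotpNr, dotpZl, dotpZr, dotp0l, dotp0r).

Lemma dotp_ge0 u : 0 <= dotp u u.
Proof. by rewrite dotpE; apply: sumr_ge0 => i _; rewrite -expr2 sqr_ge0. Qed.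

Lemma dotp_eq0 u : (dotp u u == 0) = (u == 0).
Proof.
apply/idP/eqP => [|->]; last by rewrite dotp0l.
rewrite dotpE psumr_eq0 => [/allP u0|i _]; last by rewrite -expr2 sqr_ge0.
apply/rowP => i; have /implyP/(_ isT) := u0 i (mem_index_enum _).
by rewrite mulf_eq0 orbb mxE => /eqP.
Qed.

Lemma enorm_ge0 u : 0 <= enorm u.
Proof. exact: sqrtr_ge0. Qed.

Lemma sqr_enorm u : enorm u ^+ 2 = dotp u u.
Proof. by rewrite sqr_sqrtr// dotp_ge0. Qed.

Lemma enorm_eq0 u : (enorm u == 0) = (u == 0).
Proof. by rewrite -dotp_eq0 -sqr_enorm sqrf_eq0. Qed.

Lemma dotp_le u v : dotp u v <= enorm u * enorm v.
Proof.
have [->|u0] := eqVneq u 0; first by rewrite dotp0l mulr_ge0 ?enorm_ge0.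
have [->|v0] := eqVneq v 0; first by rewrite dotp0r mulr_ge0 ?enorm_ge0.
have nu : 0 < enorm u by rewrite lt_neqAle eq_sym enorm_eq0 u0 enorm_ge0.
have nv : 0 < enorm v by rewrite lt_neqAle eq_sym enorm_eq0 v0 enorm_ge0.
have := dotp_ge0 (enorm v *: u - enorm u *: v).
rewrite !dotp_lin -!sqr_enorm (dotpC v u) => h.
have : 0 <= (enorm u * enorm v) * (enorm u * enorm v - dotp u v) by nra.
by rewrite pmulr_rge0 ?mulr_gt0// subr_ge0.
Qed.

Lemma enormN u : enorm (- u) = enorm u.
Proof. by rewrite /enorm dotpNl dotpNr opprK. Qed.

End Dotp.

Lemma dotp_row_mx (R : realType) m n (a b : 'rV[R]_m) (u v : 'rV[R]_n) :
  dotp (row_mx a u) (row_mx b v) = dotp a b + dotp u v.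
Proof. by rewrite /dotp tr_row_mx mul_row_col mxE. Qed.

Section SupportingFunctional.
Context {R : realType}.

(** Induction on the dimension: a functional dominated on the hyperplane of vanishing first
    coordinate is extended by choosing the coefficient of that coordinate. Homogeneity is assumed
    for [t > 0] only; it still forces [p 0 = 0]. *)
Lemma hahn_banach_rV n (p : 'rV[R]_n -> R) :
  (forall x y, p (x + y) <= p x + p y) ->
  (forall t x, 0 < t -> p (t *: x) = t * p x) ->
  exists a, forall x, dotp a x <= p x.
Proof.
elim: n p => [|n IH] p pD pZ.
  have p0 : p 0 = 0.
    by have := pZ 2 0 ltac:(lra); rewrite scaler0; lra.
  by exists 0 => x; have -> : x = 0; [apply/rowP => -[]|rewrite dotp0l p0].
change (forall x y : 'rV[R]_(1 + n), p (x + y) <= p x + p y) in pD.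
change (forall t (x : 'rV[R]_(1 + n)), 0 < t -> p (t *: x) = t * p x) in pZ.
pose p' (x : 'rV[R]_n) := p (row_mx (0 : 'rV_1) x : 'rV_(1 + n)).
have [a'|t x t0|a' ha'] := IH p'.
- by move=> y; rewrite /p' -[X in row_mx X _](addr0 0) -add_row_mx pD.
- by rewrite /p' -pZ// scale_row_mx scaler0.
pose P s (x : 'rV[R]_n) := p (row_mx (s%:M : 'rV_1) x : 'rV_(1 + n)).
have PD s t x y : P (s + t) (x + y) <= P s x + P t y.
  by rewrite /P raddfD/= -add_row_mx pD.
have PZ t s x : 0 < t -> P (t * s) (t *: x) = t * P s x.
  by move=> t0; rewrite /P -pZ// scale_row_mx scale_scalar_mx.
have P0 x : dotp a' x <= P 0 x by rewrite /P raddf0; exact: ha'.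
(* Admissible coefficients lie between [dotp a' y - P (-1) y] and [P 1 x - dotp a' x]; subadditivity
   at [1 + (-1) = 0] separates the two families, and [sup S] fits between them. *)
pose S := [set dotp a' y - P (-1) y | y in [set: 'rV[R]_n]].
have Sub x : ubound S (P 1 x - dotp a' x).
  move=> _ [y _ <-]; have := PD 1 (-1) x y.
  by rewrite subrr => h; have := P0 (x + y); rewrite dotpDr; lra.
have S0 : S !=set0 by exists (dotp a' 0 - P (-1) 0); exists 0.
have al1 x : sup S <= P 1 x - dotp a' x by apply: ge_sup.
have al2 y : dotp a' y - P (-1) y <= sup S.
  by apply: ub_le_sup; [exists (P 1 0 - dotp a' 0) | exists y].
exists (row_mx ((sup S)%:M : 'rV_1) a' : 'rV_(1 + n)) => x.
have -> : x = (row_mx ((x 0 0)%:M : 'rV_1) (rsubmx (x : 'rV_(1 + n)))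
    : 'rV_(1 + n)).
  have <- : lsubmx (x : 'rV_(1 + n)) = (x 0 0)%:M.
    by rewrite [LHS]mx11_scalar mxE; congr (x _ _)%:M; apply/val_inj.
  by rewrite hsubmxK.
move: (x 0 0) (rsubmx _) => s z.
rewrite -/(P s z) [X in X <= _](@dotp_row_mx _ 1 n).
rewrite [dotp _%:M _]dotpE big_ord1 !mxE !mulr1n.
have [s0|s0|->] := ltgtP s 0.
- have := al2 ((- s)^-1 *: z); rewrite dotpZr => h.
  have := PZ (- s) (- 1) ((- s)^-1 *: z) ltac:(lra).
  rewrite scalerA divff ?scale1r; last by rewrite oppr_eq0 lt_eqF.
  rewrite mulrNN mulr1 => ->.
  have -> : dotp a' z = - s * ((- s)^-1 * dotp a' z).
    by rewrite mulrA divff ?mul1r// oppr_eq0 lt_eqF.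
  by nra.
- have := al1 (s^-1 *: z); rewrite dotpZr => h.
  have := PZ s 1 (s^-1 *: z) s0.
  rewrite scalerA divff ?scale1r; last by rewrite gt_eqF.
  rewrite mulr1 => ->.
  have -> : dotp a' z = s * (s^-1 * dotp a' z).
    by rewrite mulrA divff ?mul1r// gt_eqF.
  by nra.
- by rewrite mulr0 add0r.
Qed.

(* The gauge y |-> inf {r / t | E (t y) r} of the epigraph-like set E is
   real-valued and sublinear. *)
Lemma supporting_functional n (E : 'rV[R]_n -> R -> Prop) :
  (forall x y r s t, 0 < t < 1 -> E x r -> E y s ->
     E (t *: x + (1 - t) *: y) (t * r + (1 - t) * s)) ->
  (forall r, E 0 r -> 0 <= r) ->
  (forall y, exists t r, 0 < t /\ E (t *: y) r) ->
  exists a, forall y r, E y r -> dotp a y <= r.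
Proof.
move=> Ecvx E0 Eabs.
pose S y := [set q | exists t r, [/\ 0 < t, E (t *: y) r & q = r / t]].
have Sne y : S y !=set0.
  by have [t [r [t0 h]]] := Eabs y; exists (r / t), t, r.
(* The weight [t' / (t + t')] gives both points the same factor [t t' / (t + t')], so that their
   convex combination is a multiple of [y + z]. *)
have key y z t t' r r' : 0 < t -> 0 < t' -> E (t *: y) r -> E (t' *: z) r' ->
    E ((t * t' / (t + t')) *: (y + z)) ((t' * r + t * r') / (t + t')).
  move=> t0 t'0 h h'; have tt0 : 0 < t + t' by rewrite addr_gt0.
  have := Ecvx _ _ _ _ (t' / (t + t')) _ h h'; rewrite !scalerA.
  have -> : t' / (t + t') * t = t * t' / (t + t') by field; rewrite gt_eqF.
  have -> : (1 - t' / (t + t')) * t' = t * t' / (t + t').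
    by field; rewrite gt_eqF.
  rewrite -scalerDr.
  have -> : t' / (t + t') * r + (1 - t' / (t + t')) * r' =
      (t' * r + t * r') / (t + t') by field; rewrite gt_eqF.
  by apply; rewrite divr_gt0//= ltr_pdivrMr// mul1r; lra.
(* A point of [E] on the ray of [- y] combines with one on the ray of [y] into a point over 0, where
   [E0] applies. *)
have Slb y : has_lbound (S y).
  have [t' [r' [t'0 h']]] := Eabs (- y); exists (- (r' / t')).
  move=> _ [t [r [t0 h ->]]]; have := key _ _ _ _ _ _ t0 t'0 h h'.
  rewrite subrr scaler0 => /E0; rewrite pmulr_lge0 ?invr_gt0 ?addr_gt0// => k.
  have -> : r / t = (t' * r + t * r') / (t * t') - r' / t'.
    by field; rewrite !gt_eqF.
  by rewrite lerBDr addNr divr_ge0// mulr_ge0// ltW.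
pose p y := inf (S y).
have pD y z : p (y + z) <= p y + p z.
  rewrite -lerBlDr; apply: lb_le_inf => // _ [t [r [t0 h ->]]].
  rewrite lerBlDr [leRHS]addrC -lerBlDr; apply: lb_le_inf => // _ [t' [r' [t'0 h' ->]]].
  rewrite lerBlDr; apply: ge_inf => //; exists (t * t' / (t + t')).
  exists ((t' * r + t * r') / (t + t')); split; [|exact: key|].
    by rewrite divr_gt0 ?mulr_gt0 ?addr_gt0.
  by field; rewrite !gt_eqF ?addr_gt0.
have pZle c y : 0 < c -> p (c *: y) <= c * p y.
  move=> c0; rewrite -ler_pdivrMl//; apply: lb_le_inf => // _ [t [r [t0 h ->]]].
  rewrite ler_pdivrMl//; apply: ge_inf => //; exists (t / c), r; split.
  - by rewrite divr_gt0.
  - by rewrite scalerA mulfVK// gt_eqF.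
  - by field; rewrite !gt_eqF.
have pZ c y : 0 < c -> p (c *: y) = c * p y.
  move=> c0; apply/eqP; rewrite eq_le pZle//=.
  have := pZle c^-1 (c *: y); rewrite invr_gt0 scalerA mulVf ?gt_eqF// scale1r.
  by move=> /(_ c0); rewrite ler_pdivlMl.
have [a ha] := hahn_banach_rV pD pZ; exists a => y r h.
apply: le_trans (ha y) _; apply: ge_inf => //.
by exists 1, r; rewrite scale1r divr1.
Qed.

End SupportingFunctional.

(** * The scalar function theta *)

(** Passage to the limit with an error linear in [e]. The bound [e < 1] lets [e] serve as a convex
    weight. *)
Lemma ler_addeps1 (R : realFieldType) (x y C : R) :
  (forall e, 0 < e < 1 -> x <= y + C * e) -> x <= y.
Proof.
move=> h; rewrite leNgt; apply/negP => yx.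
have C0 := normr_ge0 C; pose K := `|C| + 1 + (x - y).
have K0 : 0 < K by rewrite /K; lra.
have e01 : 0 < (x - y) / 2 / K < 1.
  by rewrite divr_gt0 ?ltr_pdivrMr//=; rewrite ?/K; lra.
have eK : (x - y) / 2 / K * K = (x - y) / 2 by rewrite divfK ?gt_eqF.
have := h _ e01; move: e01 eK; move: (_ / K) => e /andP[e0 _] eK.
have : C * e <= e * K.
  by rewrite mulrC ler_pM2l// /K; have := ler_norm C; lra.
by lra.
Qed.

Lemma ler_addeps (R : realFieldType) (x y C : R) :
  (forall e, 0 < e -> x <= y + C * e) -> x <= y.
Proof. by move=> h; apply: (@ler_addeps1 _ _ _ C) => e /andP[e0 _]; exact: h. Qed.

Definition subgrad1 (R : realType) (f : R -> R) s k :=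
  forall t, f s + k * (t - s) <= f t.

Section Theta.
Context {R : realType} (l : R -> R).
Hypothesis l_gt0 : forall x, 0 < x -> 0 < l x.
Hypothesis l_noninc : forall x y, 0 < x -> x <= y -> l y <= l x.
Hypothesis l_conc : forall x y t, 0 < x -> 0 < y -> 0 <= t <= 1 ->
  t / l x + (1 - t) / l y <= (l (t * x + (1 - t) * y))^-1.

(** Only [delta > 0] is used, where [L] is finite; [theta_rtheta] shows that this does not change
    the infimum. *)
Definition rtheta (s : R) : R :=
  inf [set l delta * (s ^+ 2 / 2) + delta | delta in `]0, +oo[%classic].

Let th := rtheta.

Lemma rtheta_le s x : 0 < x -> th s <= l x * (s ^+ 2 / 2) + x.
Proof.
move=> x0; apply: ge_inf; last by exists x => //=; rewrite in_itv/= x0.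
exists 0 => _ [y y0 <-]; move: y0; rewrite /= in_itv/= andbT => y0.
by rewrite addr_ge0 ?(ltW y0)// mulr_ge0 ?(ltW (l_gt0 y0)) ?divr_ge0 ?sqr_ge0.
Qed.

Lemma rtheta_ge a s :
  (forall x, 0 < x -> a <= l x * (s ^+ 2 / 2) + x) -> a <= th s.
Proof.
move=> h; apply: lb_le_inf.
  by exists (l 1 * (s ^+ 2 / 2) + 1); exists 1 => //=; rewrite in_itv/= ltr01.
by move=> _ [y y0 <-]; apply: h; move: y0; rewrite /= in_itv/= andbT.
Qed.

Lemma rtheta_approx s e : 0 < e ->
  exists x, 0 < x /\ l x * (s ^+ 2 / 2) + x <= th s + e.
Proof.
move=> e0; apply: contrapT => /forallNP h.
suff : th s + e <= th s by rewrite gerDl leNgt e0.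
apply: rtheta_ge => x x0; rewrite leNgt; apply/negP => k.
by apply: (h x); split=> //; exact: ltW.
Qed.

Lemma rtheta_ge0 s : 0 <= th s.
Proof.
apply: rtheta_ge => y y0.
by rewrite addr_ge0 ?(ltW y0)// mulr_ge0 ?(ltW (l_gt0 y0)) ?divr_ge0 ?sqr_ge0.
Qed.

Lemma rtheta0 : th 0 = 0.
Proof.
apply/eqP; rewrite eq_le rtheta_ge0 andbT.
apply: (@ler_addeps _ _ _ 1) => e e0.
by have := rtheta_le 0 e0; rewrite expr0n/= mul0r mulr0; lra.
Qed.

Lemma rtheta_mono s t : `|s| <= `|t| -> th s <= th t.
Proof.
move=> st; apply: rtheta_ge => x x0; apply: le_trans (rtheta_le s x0) _.
rewrite lerD2r ler_pM2l ?l_gt0// ler_pM2r ?invr_gt0 ?ltr0n//.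
by rewrite -(real_normK (num_real s)) -(real_normK (num_real t)) lerXn2r ?nnegrE.
Qed.

Lemma rthetaN s : th (- s) = th s.
Proof. by apply/eqP; rewrite eq_le !rtheta_mono ?normrN. Qed.

Lemma rtheta_norm s : th `|s| = th s.
Proof. by apply/eqP; rewrite eq_le !rtheta_mono ?normr_id. Qed.

(** Equivalently, [th s / s ^+ 2] is nonincreasing for [s > 0]: scaling multiplies the quadratic
    term by [k ^+ 2], while [delta <= k ^+ 2 * delta]. *)
Lemma rtheta_scale k s : 1 <= k -> th (k * s) <= k ^+ 2 * th s.
Proof.
move=> k1; have k0 : 0 < k ^+ 2 by rewrite exprn_gt0//; lra.
rewrite -ler_pdivrMl//; apply: rtheta_ge => x x0; rewrite ler_pdivrMl//.
apply: le_trans (rtheta_le _ x0) _.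
rewrite mulrDr exprMn [leRHS]addrC [leLHS]addrC lerD//; last by lra.
by rewrite ler_peMl ?exprn_ege1 ?(ltW x0).
Qed.

Lemma rtheta_gt0 s : s != 0 -> 0 < th s.
Proof.
move=> s0; have s2 : 0 < s ^+ 2 / 2.
  by rewrite divr_gt0// exprn_even_gt0.
have l1 := l_gt0 ltr01.
have m0 : 0 < Num.min 1 (l 1 * (s ^+ 2 / 2)).
  by rewrite lt_min ltr01 mulr_gt0.
apply: (lt_le_trans m0); apply: rtheta_ge => x x0.
rewrite ge_min; apply/orP; have [x1|x1] := leP 1 x; [left|right].
  by have := mulr_gt0 (l_gt0 x0) s2; lra.
have := l_noninc x0 (ltW x1); move: s2 (l_gt0 x0) => ? ?; nra.
Qed.

(* Joint convexity of (s, delta) |-> l delta * s^2 / 2 + delta, seen as a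
   quadratic over the concave function 1 / l. *)
Lemma rtheta_convex s t p : 0 <= p <= 1 ->
  th (p * s + (1 - p) * t) <= p * th s + (1 - p) * th t.
Proof.
move=> p01; have /andP[p0 p1] := p01; apply: (@ler_addeps _ _ _ 1) => e e0; rewrite mul1r.
have [x [x0 hx]] := rtheta_approx s e0; have [y [y0 hy]] := rtheta_approx t e0.
have z0 : 0 < p * x + (1 - p) * y by nra.
apply: le_trans (rtheta_le _ z0) _.
have := l_conc x0 y0 p01; have := l_gt0 z0.
move: (l _) => m m0 hm.
move: hx hy; have := l_gt0 x0; have := l_gt0 y0.
move: (l x) (l y) hm => a b hm b0 a0 hx hy.
suff k : m * (p * s + (1 - p) * t) ^+ 2 <= p * (a * s ^+ 2) + (1 - p) * (b * t ^+ 2).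
  have : 0 <= p * (th s + e - (a * (s ^+ 2 / 2) + x)) by apply: mulr_ge0; lra.
  have : 0 <= (1 - p) * (th t + e - (b * (t ^+ 2 / 2) + y)).
    by apply: mulr_ge0; lra.
  by lra.
have A0 : 0 <= p * (a * s ^+ 2) + (1 - p) * (b * t ^+ 2).
  have [] := (mulr_ge0 (ltW a0) (sqr_ge0 s), mulr_ge0 (ltW b0) (sqr_ge0 t)).
  by move=> ? ?; apply: addr_ge0; apply: mulr_ge0 => //; lra.
(* Cauchy-Schwarz with explicit remainder. The factor [p / a + (1 - p) / b] is at most [m^-1] by
   concavity of [1 / l]. *)
have : (p * s + (1 - p) * t) ^+ 2 <=
    (p / a + (1 - p) / b) * (p * (a * s ^+ 2) + (1 - p) * (b * t ^+ 2)).
  rewrite -subr_ge0.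
  have -> : (p / a + (1 - p) / b) * (p * (a * s ^+ 2) + (1 - p) * (b * t ^+ 2))
      - (p * s + (1 - p) * t) ^+ 2 =
      p * (1 - p) * (a * s - b * t) ^+ 2 / (a * b) by field; rewrite !gt_eqF.
  apply: divr_ge0; last by apply: mulr_ge0; exact: ltW.
  by apply: mulr_ge0 (sqr_ge0 _); apply: mulr_ge0; lra.
move=> h; have {}h := le_trans h (ler_wpM2r A0 hm).
by rewrite -ler_pdivlMl.
Qed.

(** For [|s| < |t|], the point [|t|] lies on the chord from [|s|] to [M + 1]. Since
    [M + 1 - |s| >= 1], the weight of [M + 1] is at most [|t - s|]. *)
Lemma rtheta_lip M s t : `|s| <= M -> `|t| <= M ->
  th t <= th s + `|t - s| * th (M + 1).
Proof.
move=> sM tM; rewrite -(rtheta_norm s) -(rtheta_norm t).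
have [ts|st] := leP `|t| `|s|.
  apply: (@le_trans _ _ (th `|s|)); first by rewrite rtheta_mono ?normr_id.
  by rewrite lerDl mulr_ge0 ?normr_ge0// rtheta_ge0.
have := normr_ge0 s; have : `|t| - `|s| <= `|t - s| := lerB_dist t s.
have := rtheta_ge0 (M + 1); have := rtheta_ge0 `|s|.
move: sM tM st; move: `|s| `|t| `|t - s| => {}s {}t r sM tM st th1 th2 tsr s0.
pose p := (t - s) / (M + 1 - s); have M0 : 0 < M + 1 - s by lra.
have p1 : p <= 1 by rewrite ler_pdivrMr//; lra.
have p0 : 0 <= p by rewrite divr_ge0//; lra.
have pr : p <= r by rewrite ler_pdivrMr//; nra.
have -> : t = p * (M + 1) + (1 - p) * s by rewrite /p; field; rewrite gt_eqF.
apply: le_trans (rtheta_convex _ _ _) _; first by rewrite p0.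
by nra.
Qed.

Lemma rtheta_continuous : continuous th.
Proof.
move=> s; apply/cvgrPdist_le => e e0.
pose M := `|s| + 1; pose K := th (M + 1) + 1.
have K0 : 0 < K by rewrite /K ltr_wpDl// rtheta_ge0.
near=> t.
have ts : `|s - t| <= e / K.
  by near: t; apply: cvgr_dist_le => //; exact: divr_gt0.
have t1 : `|s - t| <= 1 by near: t; apply: cvgr_dist_le.
have tM : `|t| <= M.
  have := lerB_dist t s; rewrite distrC /M; lra.
have sM : `|s| <= M by rewrite /M; lra.
have := rtheta_lip sM tM; have := rtheta_lip tM sM; rewrite (distrC t s).
have : `|s - t| * th (M + 1) <= e.
  apply: (@le_trans _ _ (e / K * K)); last by rewrite divfK ?gt_eqF.
  by apply: ler_pM => //; rewrite ?rtheta_ge0// /K; lra.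
by move=> *; rewrite ler_norml; apply/andP; split; lra.
Unshelve. all: by end_near. Qed.

Lemma subgrad1_rtheta0 : subgrad1 th 0 0.
Proof. by move=> t; rewrite rtheta0 mul0r addr0 rtheta_ge0. Qed.

(* For r <= s, an almost optimal delta for theta(s) satisfies
   l delta * r^2 / 2 <= theta(r) + e. *)
Lemma rtheta_smooth_near s t k : subgrad1 th s k -> `|t - s| <= `|s| ->
  th t <= th s + k * (t - s) + 2 * th (t - s).
Proof.
move=> hk ts; apply: (@ler_addeps _ _ _ 4) => e e0.
have [x [x0 hx]] := rtheta_approx s e0; have lx := l_gt0 x0.
(* For [y <= x] monotonicity of [l] suffices. For [y > x], near-optimality of [x] at [s] bounds
   [(l x - l y) * s ^+ 2 / 2] by [y - x + e], and [|t - s| <= |s|] transfers this to [t - s]. *)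
have h1 : l x * ((t - s) ^+ 2 / 2) <= th (t - s) + e.
  rewrite -lerBlDr; apply: rtheta_ge => y y0.
  have [yx|xy] := leP y x.
    have := l_noninc y0 yx; have := sqr_ge0 (t - s); nra.
  have := rtheta_le s y0 => hy.
  have r2 : (t - s) ^+ 2 <= s ^+ 2.
    rewrite -(real_normK (num_real s)) -(real_normK (num_real (t - s))).
    by rewrite lerXn2r ?nnegrE.
  have := l_noninc x0 (ltW xy); nra.
(* The reflection of [t] at [s]: by the parallelogram identity, the quadratics at [t] and at
   [s - (t - s)] sum to twice the one at [s] plus [l x * (t - s) ^+ 2]. *)
have h2 := hk (s - (t - s)); have h3 := rtheta_le (s - (t - s)) x0.
have h4 := rtheta_le t x0.
by nra.
Qed.

(** Convexity on the chord from 0, with [th 0 = 0], makes [th s / s] nondecreasing. *)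
Lemma rtheta_star s t : 0 < s <= t -> th s * t <= th t * s.
Proof.
move=> /andP[s0 st]; have t0 : 0 < t by lra.
have p01 : 0 <= s / t <= 1.
  by apply/andP; split; [rewrite divr_ge0 ?ltW|rewrite ler_pdivrMr// mul1r].
have := rtheta_convex t 0 p01.
rewrite mulr0 addr0 rtheta0 mulr0 addr0 divfK ?gt_eqF//.
by rewrite mulrAC ler_pdivlMr// [s * _]mulrC.
Qed.

(** The bound [th ((1 + e) * s) <= (1 + e) ^+ 2 * th s], differentiated at [e = 0]. *)
Lemma rtheta_subgrad_le s k : subgrad1 th s k -> k * s <= 2 * th s.
Proof.
move=> hk; apply: (@ler_addeps _ _ _ (th s)) => e e0.
have := hk ((1 + e) * s); have := @rtheta_scale (1 + e) s ltac:(lra).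
move=> h1 h2; have : e * (k * s) <= e * (2 * th s + th s * e) by nra.
by rewrite ler_pM2l.
Qed.

Lemma subgrad1N s k : subgrad1 th s k -> subgrad1 th (- s) (- k).
Proof.
move=> h t; rewrite rthetaN -(rthetaN t); apply: le_trans (h (- t)).
by rewrite lerD2l; lra.
Qed.

(** The constant is 6 = 4 + 2, from the case [|t - s| > s > 0]: there [th t <= th (2 * (t - s)) <= 4
    * th (t - s)], and [k * |t - s| <= 2 * th (t - s)] by [rtheta_subgrad_le] and [rtheta_star].
    Evenness reduces to [s >= 0]. *)
Lemma rtheta_smooth s t k : subgrad1 th s k ->
  th t <= th s + k * (t - s) + 6 * th (t - s).
Proof.
wlog s0 : s t k / 0 <= s.
  move=> h hk; have [/h|s0] := leP 0 s; first exact.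
  have := h (- s) (- t) (- k) _ (subgrad1N hk).
  have -> : - t - - s = - (t - s) by lra.
  by rewrite !rthetaN mulrNN; apply; rewrite oppr_ge0 ltW.
move=> hk; have T := rtheta_ge0 (t - s).
have [ts|st] := leP `|t - s| `|s|.
  by apply: le_trans (rtheta_smooth_near hk ts) _; lra.
have [s00|s0'] := eqVneq s 0.
  move: hk st T; rewrite s00 subr0 => hk _ T.
  by have := hk (- t); rewrite subr0 rthetaN rtheta0; lra.
have sgt0 : 0 < s by rewrite lt_neqAle eq_sym s0'.
have h1 : th t <= 4 * th (t - s).
  have := @rtheta_scale 2 (t - s) ltac:(lra).
  have : th t <= th (2 * (t - s)).
    apply: rtheta_mono; rewrite normrM ger0_norm//.
    by have := ler_normD (t - s) s; rewrite subrK; lra.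
  have -> : (2 : R) ^+ 2 = 4 by lra.
  by lra.
have h2 : - k * (t - s) <= 2 * th (t - s).
  have k0 : 0 <= k by have := hk 0; rewrite rtheta0; have := rtheta_ge0 s; nra.
  rewrite (ger0_norm s0) in st; have ks := rtheta_subgrad_le hk.
  have kts : - k * (t - s) <= k * `|t - s|.
    have : - (t - s) <= `|t - s| by rewrite -normrN ler_norm.
    by nra.
  have := @rtheta_star s `|t - s|; rewrite sgt0 (ltW st) rtheta_norm => /(_ isT).
  move: (`|t - s|) st kts => r sr kts m2.
  have r0 : 0 < r by lra.
  have : k * r * s <= 2 * th (t - s) * s by nra.
  by rewrite ler_pM2r//; lra.
have := rtheta_ge0 s; lra.
Qed.

End Theta.

(** * Radial functions *)

Lemma unit_direction (R : realType) d (m : 'rV[R]_d.+1) :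
  exists e, dotp e e = 1 /\ m = enorm m *: e.
Proof.
have [m0|m0] := eqVneq m 0.
  exists (delta_mx 0 0); rewrite m0 (_ : enorm 0 = 0) ?scale0r; last first.
    by apply/eqP; rewrite enorm_eq0.
  split=> //; rewrite dotpE (bigD1 ord0)//= big1 => [|i i0].
    by rewrite !mxE !eqxx mulr1 addr0.
  by rewrite !mxE (negbTE i0) mulr0.
have nm : enorm m != 0 by rewrite enorm_eq0.
exists ((enorm m)^-1 *: m); rewrite scalerA divff// scale1r; split=> //.
by rewrite !dotp_lin -sqr_enorm; field.
Qed.

Section RadialSmoothness.
Context {R : realType} (Th : R -> R).
Hypothesis Th0 : Th 0 = 0.
Hypothesis Th_ge0 : forall s, 0 <= Th s.
Hypothesis ThN : forall s, Th (- s) = Th s.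
Hypothesis Th_mono : forall s t, `|s| <= `|t| -> Th s <= Th t.
Hypothesis Th_cvx : forall s t p, 0 <= p <= 1 ->
  Th (p * s + (1 - p) * t) <= p * Th s + (1 - p) * Th t.
Hypothesis Th_cont : continuous Th.

(** The infimum of [Th s - M * s] need not be attained; the term [eta * s ^+ 2] confines the search
    to [[0, M / eta]], at the price of perturbing the slope [M] by [2 * eta * s0]. *)
Lemma prox_exists (M eta : R) : 0 <= M -> 0 < eta -> exists s0,
  subgrad1 Th s0 (M - 2 * eta * s0) /\
  forall s, Th s0 + eta * s0 ^+ 2 - M * s0 <= Th s + eta * s ^+ 2 - M * s.
Proof.
move=> M0 eta0; pose G s := Th s + (eta * s ^+ 2 - M * s).
pose b := M / eta; have b0 : 0 <= b by rewrite divr_ge0// ltW.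
have Mb : M = b * eta by rewrite /b divfK ?gt_eqF.
have Gcont : continuous G.
  move=> s; apply: cvgD; first exact: Th_cont.
  by apply: cvgB; apply: cvgM; [exact: cvg_cst|exact: exprn_continuous|exact: cvg_cst|].
have [s0 _ hs0] := EVT_min b0 (continuous_subspaceT Gcont).
have min s : G s0 <= G s.
  have [sb|sb] := boolP (s \in `[0, b]); first exact: hs0.
  have : G s0 <= G 0 by apply: hs0; rewrite in_itv/= lexx.
  rewrite {2}/G Th0 expr0n/= !mulr0 subr0 addr0 => h; apply: (le_trans h).
  apply: addr_ge0 => //; rewrite Mb.
  have -> : eta * s ^+ 2 - b * eta * s = eta * (s * (s - b)) by ring.
  move: sb; rewrite in_itv/= negb_and -!ltNge => /orP[] sb; apply: mulr_ge0; nra.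
exists s0; split=> [t|s]; last by have := min s; rewrite /G; lra.
apply: (@ler_addeps1 _ _ _ (eta * (t - s0) ^+ 2)) => p /andP[p0 p1].
have := min (p * t + (1 - p) * s0); rewrite /G => h.
have k : Th (p * t + (1 - p) * s0) <= p * Th t + (1 - p) * Th s0.
  by apply: Th_cvx; rewrite !ltW.
rewrite -(ler_pM2l p0); nra.
Qed.

Variables (a delta : R).
Hypothesis Th_smooth : forall s t k, subgrad1 Th s k ->
  Th t <= Th s + k * (t - s) + (a * (t - s) ^+ 2 + delta).

(* <e, w> is an average of |w| and -|w|, and the bound at w is the same average
   of the one-dimensional bounds at |w| and -|w|. *)
Lemma radial_smooth d (e w : 'rV[R]_d) s k : dotp e e = 1 -> subgrad1 Th s k ->
  Th (enorm w) <= Th s + k * (dotp e w - s) +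
    (a * dotp (w - s *: e) (w - s *: e) + delta).
Proof.
move=> e1 hk; rewrite !dotp_lin (dotpC w e) e1 -sqr_enorm.
have [w0|w0] := eqVneq w 0.
  have -> : enorm w = 0 by apply/eqP; rewrite enorm_eq0 w0.
  rewrite w0 dotp0r; apply: le_trans (Th_smooth 0 hk) _.
  by rewrite le_eqVlt; apply/orP; left; apply/eqP; ring.
have r0 : 0 < enorm w by rewrite lt_neqAle enorm_ge0 eq_sym enorm_eq0 w0.
have ew : `|dotp e w| <= enorm w.
  have ne : enorm e = 1 by rewrite /enorm e1 sqrtr1.
  rewrite ler_norml; apply/andP; split.
    by have := dotp_le (- e) w; rewrite enormN ne mul1r dotpNl; lra.
  by have := dotp_le e w; rewrite ne mul1r.
pose p := (1 + dotp e w / enorm w) / 2.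
have hp : dotp e w = p * enorm w + (1 - p) * - enorm w.
  by rewrite /p; field; rewrite gt_eqF.
move: ew; rewrite ler_norml => /andP[ew1 ew2].
have [p0 p1] : 0 <= p /\ p <= 1.
  have : - 1 <= dotp e w / enorm w <= 1.
    by rewrite ler_pdivlMr// ler_pdivrMr// mulN1r mul1r ew1.
  by rewrite /p; split; lra.
have h1 := Th_smooth (enorm w) hk.
have := Th_smooth (- enorm w) hk; rewrite ThN => h2.
rewrite hp; move: (enorm w) (p) p0 p1 h1 h2 => r q q0 q1 h1 h2.
by nra.
Qed.

(* Strong convexity of the conjugate of Th o |.|, stated for its affine
   minorants. *)
Lemma radial_minorant d (p q v : 'rV[R]_d.+1) b c t : 0 < t < 1 ->
  (forall z, dotp p z + b <= Th (enorm z)) ->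
  (forall z, dotp q z + c <= Th (enorm z)) ->
  forall z, dotp ((1 - t) *: p + t *: q) z + (1 - t) * b +
    t * (c + (1 - t) * dotp (q - p) v - (a * dotp v v + delta))
    <= Th (enorm z).
Proof.
move=> /andP[t0 t1] hp hq z.
set m := (1 - t) *: p + t *: q.
set C := (1 - t) * b + t * (c + (1 - t) * dotp (q - p) v - (a * dotp v v + delta)).
have [e [e1 em]] := unit_direction m.
have nm0 := enorm_ge0 m.
(* Since [dotp m z <= enorm m * enorm z], the claim becomes one-dimensional along the direction [e]
   of [m]. *)
suff key s : enorm m * s + C <= Th s.
  apply: le_trans (key (enorm z)); rewrite -addrA lerD2r; exact: dotp_le.
apply: (@ler_addeps _ _ _ (s ^+ 2 + t ^+ 2 * dotp e v ^+ 2)) => eta eta0.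
have [s0 [hs0 min]] := prox_exists nm0 eta0.
have := min s.
(* With weights [1 - t] and [t], the minorants are tested at [s0 *: e] and at [s0 *: e + v];
   [radial_smooth] compares [Th] at these points. *)
have h1 := hp (s0 *: e); have h2 := hq (s0 *: e + v).
have h3 := radial_smooth (s0 *: e + v) e1 hs0.
have Ts : Th (enorm (s0 *: e)) = Th s0.
  have -> : enorm (s0 *: e) = `|s0|.
    by rewrite /enorm !dotp_lin e1 mulr1 -expr2 sqrtr_sqr.
  by apply/eqP; rewrite eq_le !Th_mono ?normr_id.
have vE : s0 *: e + v - s0 *: e = v by rewrite addrC addKr.
rewrite Ts in h1; rewrite vE !dotp_lin e1 in h3.
rewrite !dotp_lin in h2; rewrite dotpZr in h1.
have hm1 : (1 - t) * dotp p e + t * dotp q e = enorm m.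
  by rewrite -!dotpZl -dotpDl -/m {1}em dotpZl e1 mulr1.
have hmv : (1 - t) * dotp p v + t * dotp q v = enorm m * dotp e v.
  by rewrite -!dotpZl -dotpDl -/m {1}em dotpZl.
have CE : C = (1 - t) * b + t * (c + (1 - t) * (dotp q v - dotp p v)
  - (a * dotp v v + delta)) by rewrite /C !dotp_lin.
(* Completing the square absorbs the cross term from the slope error [2 * eta * s0], leaving only
   [eta * t ^+ 2 * dotp e v ^+ 2]. *)
have sq : 0 <= eta * (s0 + t * dotp e v) ^+ 2.
  by rewrite mulr_ge0 ?sqr_ge0// ltW.
have {}h1 := ler_wpM2l (ltac:(lra) : 0 <= 1 - t) h1.
have {}h2 := ler_wpM2l (ltW t0) h2; have {}h3 := ler_wpM2l (ltW t0) h3.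
have : (1 - t) * (s0 * dotp p e) + t * (s0 * dotp q e) = s0 * enorm m.
  by rewrite -hm1; ring.
move: CE hm1 hmv sq h1 h2 h3; clear -t0 t1.
by nra.
Qed.

End RadialSmoothness.

(** * The interpolating function *)

Lemma dotp_continuous (R : realType) d (u : 'rV[R]_d) : continuous (dotp u).
Proof.
suff h (r : seq 'I_d) : continuous (fun y : 'rV[R]_d => \sum_(i <- r) u 0 i * y 0 i).
  have -> : dotp u = fun y => \sum_i u 0 i * y 0 i; last exact: h.
  by apply/funext => y; rewrite dotpE.
elim: r => [|i r IH].
  rewrite (_ : (fun _ => _) = fun=> 0); first exact: cst_continuous.
  by apply/funext => y; rewrite big_nil.
rewrite (_ : (fun _ => _) = fun y : 'rV[R]_d =>
    u 0 i * y 0 i + \sum_(j <- r) u 0 j * y 0 j); last first.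
  by apply/funext => y; rewrite big_cons.
move=> x; apply: (@continuousD _ _ _ (fun y : 'rV[R]_d => u 0 i * y 0 i)).
  apply: (@continuousM _ _ (fun=> u 0 i) (fun y : 'rV[R]_d => y 0 i)).
    exact: cst_continuous.
  exact: coord_continuous.
exact: IH.
Qed.

Section Interpolation.
Context {R : realType} (Th : R -> R).
Hypothesis Th0 : Th 0 = 0.
Hypothesis Th_ge0 : forall s, 0 <= Th s.
Hypothesis ThN : forall s, Th (- s) = Th s.
Hypothesis Th_mono : forall s t, `|s| <= `|t| -> Th s <= Th t.
Hypothesis Th_cvx : forall s t p, 0 <= p <= 1 ->
  Th (p * s + (1 - p) * t) <= p * Th s + (1 - p) * Th t.
Hypothesis Th_cont : continuous Th.
Variables (n : nat) (I : Type) (i0 : I) (x g : I -> 'rV[R]_n.+1) (f : I -> R).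
Hypothesis interp : forall i j s,
  dotp (g j) (x i - x j) + enorm (g i - g j) * s - Th s <= f i - f j.

Definition common_minorant (u : 'rV[R]_n.+1) (b : R) := forall i z,
  dotp u z + b <= f i + dotp (g i) (z - x i) + Th (enorm (z - x i)).

(** The closed convex hull of the infimum of the pieces. The real [sup] is meaningful: the set is
    nonempty by [interp_minorant] and bounded by the value of any piece. *)
Definition interpolant (z : 'rV[R]_n.+1) : R :=
  sup [set r | exists u b, common_minorant u b /\ r = dotp u z + b].

Let F := interpolant.

(** The interpolation condition at [s = enorm (z - x i)], with Cauchy-Schwarz for [g j - g i]. Hence
    the interpolant takes the value [f j] at [x j], with subgradient [g j]. *)
Lemma interp_minorant j : common_minorant (g j) (f j - dotp (g j) (x j)).
Proof.
move=> i z; have := interp i j (enorm (z - x i)).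
have := dotp_le (- (g i - g j)) (z - x i); rewrite enormN.
rewrite !dotp_lin; lra.
Qed.

Lemma interpolant_le z v :
  (forall u b, common_minorant u b -> dotp u z + b <= v) -> F z <= v.
Proof.
move=> h; apply: ge_sup; last by move=> _ [u [b [/h k ->]]].
by eexists; exists (g i0), (f i0 - dotp (g i0) (x i0)); split;
  [exact: interp_minorant|].
Qed.

Lemma interpolant_ge z u b : common_minorant u b -> dotp u z + b <= F z.
Proof.
move=> h; apply: ub_le_sup; last by exists u, b.
by exists (f i0 + dotp (g i0) (z - x i0) + Th (enorm (z - x i0)))
  => _ [v [c [/(_ i0 z) k ->]]].
Qed.

Lemma interpolant_le_piece i z :
  F z <= f i + dotp (g i) (z - x i) + Th (enorm (z - x i)).
Proof. by apply: interpolant_le => u b; exact. Qed.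

Lemma interpolant_ge_affine j z : f j + dotp (g j) (z - x j) <= F z.
Proof.
by have := interpolant_ge z (interp_minorant j); rewrite !dotp_lin; lra.
Qed.

Lemma interpolantE j : F (x j) = f j.
Proof.
apply/eqP; rewrite eq_le; apply/andP; split.
  have := interpolant_le_piece j (x j).
  rewrite subrr dotp0r (_ : enorm 0 = 0) ?Th0 ?addr0//.
  by apply/eqP; rewrite enorm_eq0.
by have := interpolant_ge_affine j (x j); rewrite subrr dotp0r addr0.
Qed.

Lemma interpolant_convex y z t : 0 <= t <= 1 ->
  F (t *: y + (1 - t) *: z) <= t * F y + (1 - t) * F z.
Proof.
move=> /andP[t0 t1]; apply: interpolant_le => u b ub.
have hy := ler_wpM2l t0 (interpolant_ge y ub).
have hz := ler_wpM2l (ltac:(lra) : 0 <= 1 - t) (interpolant_ge z ub).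
by rewrite !dotp_lin; lra.
Qed.

Lemma interpolant_lsc : lower_semicontinuous (fun z => (F z)%:E).
Proof.
move=> z a; rewrite lte_fin => aF.
have [u [b [ub ab]]] : exists u b, common_minorant u b /\ a < dotp u z + b.
  apply: contrapT => h; suff : F z <= a by rewrite leNgt aF.
  apply: interpolant_le => u b ub; rewrite leNgt; apply/negP => k.
  by apply: h; exists u, b.
exists [set y | a - b < dotp u y].
  apply: (@dotp_continuous _ _ u z [set r | a - b < r]).
  by apply: lt_nbhsr; lra.
move=> y /= k; rewrite lte_fin; apply: lt_le_trans (interpolant_ge y ub).
by lra.
Qed.

(** A minorant [q] mixed with weight [t] into the supporting line [p] at [y] is again a common
    minorant, with the gain from [radial_minorant]. Its value at [y] is at most [F y]; dividing by
    [t] and letting [t] tend to 0 bounds [q] at [z]. *)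
Lemma interpolant_smooth (a delta : R) :
  (forall s t k, subgrad1 Th s k ->
    Th t <= Th s + k * (t - s) + (a * (t - s) ^+ 2 + delta)) ->
  forall y z p, (forall w, F y + dotp p (w - y) <= F w) ->
  F z <= F y + dotp p (z - y) + a * dotp (z - y) (z - y) + delta.
Proof.
move=> sm y z p hp; apply: interpolant_le => q c hq.
pose v := z - y; have zE : z = y + v by rewrite addrC subrK.
apply: (@ler_addeps1 _ _ _ (dotp (q - p) v)) => t t01.
have /andP[t0 t1] := t01.
(* Subtracting [g i] and recentring at [x i] reduces each piece to [Th] of the norm. The difference
   [q - p] is unaffected, so one constant serves all [i]. *)
have hm : common_minorant ((1 - t) *: p + t *: q) ((1 - t) * (F y - dotp p y) +
    t * (c + (1 - t) * dotp (q - p) v - (a * dotp v v + delta))).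
  move=> i w.
  have hp' w' : dotp (p - g i) w' + (F y + dotp p (x i - y) - f i)
      <= Th (enorm w').
    have := hp (w' + x i); have := interpolant_le_piece i (w' + x i).
    by rewrite addrK !dotp_lin; lra.
  have hq' w' : dotp (q - g i) w' + (c + dotp q (x i) - f i) <= Th (enorm w').
    by have := hq i (w' + x i); rewrite addrK !dotp_lin; lra.
  have := radial_minorant Th0 Th_ge0 ThN Th_mono Th_cvx Th_cont sm v t01
    hp' hq' (w - x i).
  have -> : q - g i - (p - g i) = q - p by rewrite opprB addrA subrK.
  by rewrite !dotp_lin; lra.
have := interpolant_ge y hm; rewrite -/v zE !dotp_lin => h.
by rewrite -(ler_pM2l t0); lra.
Qed.

End Interpolation.

(** * The self-smoothness constant and the lower bound *)

Section SelfSmoothness.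
Context {R : realType} (L : R -> \bar R).
Hypothesis hL : inexact_smoothness_function L.

Let l (x : R) : R := fine (L x).
Let th := rtheta l.

Lemma isf_EFin (x : R) : 0 < x -> L x = (l x)%:E.
Proof.
move=> x0; have := isf_gt0 hL (ltW x0); have := isf_fin hL x0.
by rewrite /l; case: (L x).
Qed.

Lemma isf_fine_gt0 (x : R) : 0 < x -> 0 < l x.
Proof. by move=> x0; rewrite -lte_fin -isf_EFin// isf_gt0// ltW. Qed.

Lemma isf_fine_noninc (x y : R) : 0 < x -> x <= y -> l y <= l x.
Proof.
move=> x0 xy; rewrite -lee_fin -!isf_EFin//; last exact: lt_le_trans xy.
by apply: isf_noninc => //; exact: ltW.
Qed.

Lemma isf_fine_conc (x y t : R) : 0 < x -> 0 < y -> 0 <= t <= 1 ->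
  t / l x + (1 - t) / l y <= (l (t * x + (1 - t) * y))^-1.
Proof.
move=> x0 y0 t01; have /andP[t0 t1] := t01.
have z0 : 0 < t * x + (1 - t) * y by nra.
have := isf_convexV hL (x := x) (y := y) (t := t).
rewrite /= !in_itv/= !andbT (ltW x0) (ltW y0) => /(_ isT isT t01).
rewrite [_ *: _]/(t * x) [_ *: _]/((1 - t) * y) !isf_EFin//.
rewrite !inver !gt_eqF ?isf_fine_gt0//.
by rewrite -!EFinN -!EFinM -EFinD lee_fin !mulrN -opprD lerN2.
Qed.

Let l_gt0 := isf_fine_gt0.
Let l_noninc := isf_fine_noninc.
Let l_conc := isf_fine_conc.

(** The term [delta = 0] adds nothing: if [L 0] is finite it bounds every [L e], and [e] tends to 0;
    if it is infinite the term is [+oo], except at [s = 0], where both sides are 0. *)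
Lemma theta_rtheta (s : R) : theta L s = (th s)%:E.
Proof.
apply/eqP; rewrite eq_le; apply/andP; split.
  apply/lee_addgt0Pr => e e0; have [x [x0 hx]] := rtheta_approx l s e0.
  apply: (@le_trans _ _ (L x * (s ^+ 2 / 2)%:E + x%:E)%E).
    by apply: ereal_inf_lbound; exists x => //=; rewrite in_itv/= ltW.
  by rewrite isf_EFin// -EFinM -!EFinD lee_fin.
apply: le_ereal_inf_tmp => _ [x xP <-].
move: xP; rewrite /= in_itv/= andbT le_eqVlt => /orP[/eqP <-|x0]; last first.
  by rewrite isf_EFin// -EFinM -EFinD lee_fin; exact: rtheta_le.
have := isf_gt0 hL (lexx 0); case L0 : (L 0) => [a| |]// a0.
  rewrite -EFinM -EFinD lee_fin addr0.
  apply: (@ler_addeps _ _ _ 1) => e e0; rewrite mul1r.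
  apply: le_trans (rtheta_le l_gt0 s e0) _; rewrite lerD2r.
  apply: ler_wpM2r; first by rewrite divr_ge0 ?sqr_ge0.
  by rewrite -lee_fin -isf_EFin// -L0; apply: isf_noninc => //; exact: ltW.
have [->|s0] := eqVneq s 0.
  by rewrite expr0n/= mul0r mule0 add0e /th rtheta0.
by rewrite gt0_mulye ?leey// lte_fin divr_gt0// exprn_even_gt0.
Qed.

Lemma rtheta_lee (s x : R) : 0 <= x ->
  ((th s)%:E <= L x * (s ^+ 2 / 2)%:E + x%:E)%E.
Proof.
move=> x0; rewrite -theta_rtheta; apply: ereal_inf_lbound; exists x => //=.
by rewrite in_itv/= x0.
Qed.

Let theta1 (s : 'rV[R]_1) : \bar R := theta L (s 0 0).

Lemma dotp1E (u v : 'rV[R]_1) : dotp u v = u 0 0 * v 0 0.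
Proof. by rewrite dotpE big_ord1. Qed.

Lemma subgradient_theta1 (x g : 'rV[R]_1) :
  subgradient theta1 x g <-> subgrad1 th (x 0 0) (g 0 0).
Proof.
rewrite /subgradient /theta1; split=> [[_ h] t|h].
  by have := h (const_mx t); rewrite !theta_rtheta -EFinD lee_fin dotp1E !mxE.
split=> [|z]; first by rewrite theta_rtheta.
by rewrite !theta_rtheta -EFinD lee_fin dotp1E !mxE; exact: h.
Qed.

Let self_smooth_const (c : R) := forall s t k, subgrad1 th s k ->
  th t <= th s + k * (t - s) + c * th (t - s).

(** With [delta = c * x], the infimum over [delta] of the error term
    [c * L (delta / c) * r ^+ 2 / 2 + delta] is [c * th r]. *)
Lemma inexactly_smooth_theta (c : R) : 0 < c ->
  inexactly_smooth (fun delta => c%:E * L (delta / c))%E theta1 <->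
  self_smooth_const c.
Proof.
move=> c0; split=> [[_ _ _ h] s t k hk|h].
  rewrite -lerBlDl -ler_pdivrMl//; apply: rtheta_ge => // x x0.
  rewrite ler_pdivrMl// lerBlDl.
  have hk' : subgradient theta1 (const_mx s) (const_mx k).
    by apply/subgradient_theta1; rewrite !mxE.
  have := h (const_mx s) (const_mx t) (const_mx k) (c * x) hk'.
  rewrite mulr_ge0 ?(ltW c0) ?(ltW x0)// => /(_ isT).
  rewrite /theta1 !theta_rtheta sqr_enorm !dotp1E !mxE [c * x]mulrC mulfK ?gt_eqF//.
  by rewrite isf_EFin// -!EFinM -!EFinD lee_fin; lra.
split.
- move=> y b; rewrite /theta1 theta_rtheta lte_fin => bth.
  exists [set z : 'rV[R]_1 | b < th (z 0 0)]; last first.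
    by move=> z; rewrite /= theta_rtheta.
  have cont : {for y, continuous (fun z : 'rV[R]_1 => th (z 0 0))}.
    apply: (@continuous_comp _ _ _ (fun z : 'rV[R]_1 => z 0 0) th).
      exact: coord_continuous.
    exact: rtheta_continuous.
  by apply: (cont [set r | b < r]); exact: lt_nbhsr.
- move=> y z t _ _ t01; rewrite /theta1 !theta_rtheta -!EFinM -EFinD lee_fin !mxE.
  exact: rtheta_convex.
- by split=> [z|]; [|exists 0]; rewrite /theta1 theta_rtheta ?ltNyr ?ltry.
move=> y z g delta /subgradient_theta1 hg d0.
have := h _ (z 0 0) _ hg; have := @rtheta_lee (z 0 0 - y 0 0) (delta / c).
rewrite divr_ge0 ?(ltW c0)// => /(_ isT).
rewrite /theta1 !theta_rtheta sqr_enorm !dotp1E !mxE -expr2.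
move: (z 0 0 - _) => r h1 h2.
apply: (@le_trans _ _ ((th (y 0 0) + g 0 0 * r)%:E
    + c%:E * (L (delta / c) * (r ^+ 2 / 2)%:E + (delta / c)%:E))%E).
  apply: (@le_trans _ _ ((th (y 0 0) + g 0 0 * r)%:E + c%:E * (th r)%:E)%E).
    by rewrite -EFinM -EFinD lee_fin.
  by apply: leeD => //; apply: lee_wpmul2l => //; rewrite lee_fin ltW.
rewrite ge0_muleDr; last 2 first.
- apply: mule_ge0; last by rewrite lee_fin divr_ge0 ?sqr_ge0.
  by apply: ltW; apply: isf_gt0 => //; rewrite divr_ge0// ltW.
- by rewrite lee_fin divr_ge0// ltW.
by rewrite -EFinM [c * _]mulrC divfK ?gt_eqF// EFinD muleA addeA.
Qed.

Lemma self_smooth_const6 : self_smooth_const 6.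
Proof. by move=> s t k; exact: rtheta_smooth. Qed.

(** At [s = 0] with slope 0 and [t = 1], the inequality reads [th 1 <= c * th 1], where
    [th 1 > 0]. *)
Lemma self_smooth_const_ge1 c : self_smooth_const c -> 1 <= c.
Proof.
move=> /(_ 0 1 0 (subgrad1_rtheta0 l_gt0)).
rewrite /th rtheta0// mul0r !add0r subr0 ler_pMl// -/th.
by apply: rtheta_gt0 => //; exact: oner_neq0.
Qed.

Let cL := self_smoothness L.

Lemma has_inf_self_smoothness : has_inf [set c : R | 0 < c /\
  inexactly_smooth (fun delta => c%:E * L (delta / c))%E theta1].
Proof.
split; last first.
  by exists 1 => c [c0 /(inexactly_smooth_theta c0)]; exact: self_smooth_const_ge1.
exists 6; split; first by lra.
by apply/inexactly_smooth_theta; [lra|exact: self_smooth_const6].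
Qed.

Lemma self_smoothness_ge1 : 1 <= cL.
Proof.
apply: lb_le_inf; first by case: has_inf_self_smoothness.
by move=> c [c0 /(inexactly_smooth_theta c0)]; exact: self_smooth_const_ge1.
Qed.

(** The infimum is attained because the inequality is closed in [c]. *)
Lemma self_smoothnessP : self_smooth_const cL.
Proof.
move=> s t k hk; apply: (@ler_addeps _ _ _ (th (t - s))) => e e0.
have [c [c0 /(inexactly_smooth_theta c0)/(_ s t k hk) h] ce] :=
  inf_adherent e0 has_inf_self_smoothness.
by have := ler_wpM2r (rtheta_ge0 l_gt0 (t - s)) (ltW ce); rewrite -/cL -/th; lra.
Qed.

Lemma self_scaled_gt0 x : 0 <= x -> (0 < self_scaled L x)%E.
Proof.
move=> x0; have c1 := self_smoothness_ge1; have c0 : 0 < cL by lra.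
rewrite /self_scaled -/cL inver gt_eqF//; apply: mule_gt0.
  by apply: (isf_gt0 hL); rewrite mulr_ge0// ltW.
by rewrite lte_fin invr_gt0.
Qed.

(** At [delta = x / cL] the objective of the scaled function is [cL^-1] times that of [L] at [x]. *)
Lemma theta_self_scaled (s : R) : (theta (self_scaled L) s <= (th s / cL)%:E)%E.
Proof.
have c1 := self_smoothness_ge1; have c0 : 0 < cL by lra.
apply/lee_addgt0Pr => e e0.
have [x [x0 hx]] := rtheta_approx l s (mulr_gt0 c0 e0).
apply: (@le_trans _ _ (self_scaled L (x / cL) * (s ^+ 2 / 2)%:E + (x / cL)%:E)%E).
  apply: ereal_inf_lbound; exists (x / cL) => //=.
  by rewrite in_itv/= divr_ge0// ltW.
rewrite /self_scaled -/cL inver gt_eqF// [cL * _]mulrC divfK ?gt_eqF//.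
rewrite isf_EFin// -!EFinM -!EFinD lee_fin.
rewrite -(ler_pM2r c0) !mulrDl !divfK ?gt_eqF// [e * _]mulrC.
by apply: le_trans hx; rewrite lerD2r mulrAC divfK ?gt_eqF.
Qed.

End SelfSmoothness.

Section LowerBound.
Context {R : realType} (L : R -> \bar R).
Hypothesis hL : inexact_smoothness_function L.

Lemma Q_interp_self_scaled N d (x : star_index N -> 'rV[R]_d)
    (f : star_index N -> R) (g : star_index N -> 'rV[R]_d) i j s :
  (0 <= Q_interp (self_scaled L) x f g i j)%E ->
  dotp (g j) (x i - x j) + enorm (g i - g j) * s
    - rtheta (fun y => fine (L y)) s / self_smoothness L <= f i - f j.
Proof.
move=> Q0; set v := f i - f j - dotp (g j) (x i - x j).
have h : (theta_conj (self_scaled L) (enorm (g i - g j)) <= v%:E)%E.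
  move: Q0; rewrite /Q_interp -/v.
  case: theta_conj => [q| |]//; last by rewrite leNye.
  by rewrite -EFinB !lee_fin subr_ge0.
have : ((enorm (g i - g j) * s)%:E - theta (self_scaled L) s <= v%:E)%E.
  by apply: le_trans h; apply: ereal_sup_ubound; exists s.
move=> {}h; have : ((enorm (g i - g j) * s)%:E -
    (rtheta (fun y => fine (L y)) s / self_smoothness L)%:E <= v%:E)%E.
  by apply: le_trans h; apply: leeB => //; exact: theta_self_scaled.
by rewrite -EFinB lee_fin /v; lra.
Qed.

Lemma p_interp_self_scaled_le d N D (W : 'M[R]_N) :
  (p_interp d.+1 D W (self_scaled L) <= p_true d.+1 D W L)%E.
Proof.
apply: ge_ereal_sup => _ [x [f [g [[xit g0 xD Q0] ->]]]].
have c1 := self_smoothness_ge1 hL; set c := self_smoothness L in c1.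
have c0 : 0 < c by lra.
pose l y := fine (L y).
have l_gt0 := isf_fine_gt0 hL; have l_noninc := isf_fine_noninc hL.
have l_conc := isf_fine_conc hL.
pose Th s := rtheta l s / c.
have Th0 : Th 0 = 0 by rewrite /Th rtheta0// mul0r.
have Th_ge0 s : 0 <= Th s by rewrite divr_ge0 ?rtheta_ge0// ltW.
have ThN s : Th (- s) = Th s by rewrite /Th rthetaN.
have Th_mono s t : `|s| <= `|t| -> Th s <= Th t.
  by move=> st; rewrite ler_pM2r ?invr_gt0//; exact: rtheta_mono.
have Th_cvx s t p : 0 <= p <= 1 ->
    Th (p * s + (1 - p) * t) <= p * Th s + (1 - p) * Th t.
  by move=> p01; rewrite /Th !mulrA -mulrDl ler_pM2r ?invr_gt0// rtheta_convex.
have Th_cont : continuous Th.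
  move=> s; apply: (@continuousM _ _ (rtheta l) (fun=> c^-1)).
    exact: rtheta_continuous.
  exact: cst_continuous.
have interp i j s : dotp (g j) (x i - x j) + enorm (g i - g j) * s - Th s
    <= f i - f j by apply: Q_interp_self_scaled; exact: Q0.
pose F := interpolant Th x g f.
have FE i : F (x i) = f i := interpolantE Th0 None interp i.
have Fge i z : f i + dotp (g i) (z - x i) <= F z :=
  interpolant_ge_affine None interp i z.
have sub i : subgradient (fun z => (F z)%:E) (x i) (g i).
  by split=> // z; rewrite -EFinD lee_fin FE; exact: Fge.
apply: ereal_sup_ubound.
exists (fun z => (F z)%:E), (x None), (fun i => x (Some i)), (fun i => g (Some i)).
split; last by rewrite !FE -EFinB.
split=> //.
- split.
  + exact: (interpolant_lsc None).
  + move=> y z t _ _ t01; rewrite -!EFinM -EFinD lee_fin.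
    exact: (interpolant_convex None).
  + by split=> [z|]; [|exists 0]; rewrite ?ltNyr ?ltry.
  + move=> y z p delta [_ hp] d0; rewrite sqr_enorm.
    have {}hp w : F y + dotp p (w - y) <= F w.
      by have := hp w; rewrite -EFinD lee_fin.
    have := isf_gt0 hL d0; case La : (L delta) => [a| |]// _; last first.
      have [->|zy] := eqVneq z y.
        by rewrite subrr !dotp0r mul0r mule0 !adde0 -EFinD lee_fin lerDl.
      rewrite gt0_mulye ?leey//= lte_fin divr_gt0//.
      by rewrite lt_neqAle dotp_ge0 eq_sym dotp_eq0 subr_eq0 zy.
    rewrite -EFinM -!EFinD lee_fin.
    (* A slope [k] of [Th] is a slope [c * k] of theta; self-smoothness divided by [c] leaves the
       error [theta (t - s)], which the choice [delta] bounds by [a / 2 * (t - s) ^+ 2 + delta]. *)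
    have sm s t k : subgrad1 Th s k ->
        Th t <= Th s + k * (t - s) + (a / 2 * (t - s) ^+ 2 + delta).
      move=> hk.
      have hk' : subgrad1 (rtheta l) s (c * k).
        move=> u; have := hk u; rewrite /Th -(ler_pM2r c0) mulrDl.
        by rewrite !divfK ?gt_eqF//; lra.
      have := self_smoothnessP hL t hk'; rewrite -/c -/l => h.
      have := rtheta_lee hL (t - s) d0; rewrite La -EFinM -EFinD lee_fin -/l => h'.
      rewrite -(ler_pM2r c0) /Th !mulrDl !divfK ?gt_eqF//; nra.
    have := interpolant_smooth Th0 Th_ge0 ThN Th_mono Th_cvx Th_cont None interp
      sm z hp.
    by rewrite -/F; lra.
- by move=> y; rewrite lee_fin FE; have := Fge None y; rewrite g0 dotp0l addr0.
- by move: xD; rewrite subr_ge0.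
Qed.

End LowerBound.

(** * The upper bound *)

(** A supporting functional of the epigraph translated to [(x, f x)], which is absorbing since [f]
    is finite everywhere. *)
Lemma convex_subgradient (R : realType) d (f : 'rV[R]_d -> R) x :
  (forall y z t, 0 <= t <= 1 ->
    f (t *: y + (1 - t) *: z) <= t * f y + (1 - t) * f z) ->
  exists g, forall z, f x + dotp g (z - x) <= f z.
Proof.
move=> fcvx.
have [||y|g hg] := @supporting_functional R d
    (fun y r => f (x + y) <= f x + r).
- move=> y z r s t /andP[t0 t1] hy hz.
  have -> : x + (t *: y + (1 - t) *: z) = t *: (x + y) + (1 - t) *: (x + z).
    by rewrite !scalerDr [RHS]addrACA -scalerDl [t + _]addrC subrK scale1r.
  apply: le_trans (fcvx _ _ _ _) _; first by rewrite !ltW.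
  by nra.
- by move=> r; rewrite addr0 lerDl.
- by exists 1, (f (x + y) - f x); rewrite scale1r [leRHS]addrC subrK.
exists g => z; rewrite -lerBrDl; apply: hg.
by rewrite [x + _]addrC [leRHS]addrC !subrK.
Qed.

Section UpperBound.
Context {R : realType} (L : R -> \bar R).
Hypothesis hL : inexact_smoothness_function L.

Lemma inexactly_smooth_interp d (f : 'rV[R]_d -> \bar R) x y gx gy :
  inexactly_smooth L f -> subgradient f x gx -> subgradient f y gy ->
  (theta_conj L (enorm (gx - gy)) <=
    (fine (f x) - fine (f y) - dotp gy (x - y))%:E)%E.
Proof.
move=> [_ _ _ fsm] hx hy; rewrite theta_conjE; last by move=> ? /(isf_gt0 hL).
have [/fineK fx hx'] := hx; have [/fineK fy hy'] := hy.
move: (fine (f x)) (fine (f y)) fx fy => a b fx fy.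
apply: ge_ereal_sup => _ [delta dP <-].
have {dP} d0 : 0 <= delta by move: dP; rewrite /= in_itv/= andbT.
have := isf_gt0 hL d0; case Ll : (L delta) => [l| |]//; last first.
  move=> _; rewrite invey mule0 sub0e -EFinN lee_fin.
  by have := hy' x; rewrite -fx -fy -EFinD lee_fin; lra.
rewrite lte_fin => l0; rewrite inver gt_eqF// -EFinM -EFinB lee_fin sqr_enorm.
set p := gx - gy.
(* This point minimizes the quadratic upper bound at [x] minus the affine lower bound at [y]. *)
have h1 := hy' (x - l^-1 *: p).
have := fsm x (x - l^-1 *: p) gx delta hx d0.
move=> /(le_trans h1); rewrite -fx -fy Ll sqr_enorm -EFinM -!EFinD lee_fin.
have -> : x - l^-1 *: p - x = - (l^-1 *: p) by rewrite addrC addKr.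
have -> : x - l^-1 *: p - y = (x - y) - l^-1 *: p by rewrite addrAC.
have pp : dotp gx p - dotp gy p = dotp p p by rewrite /p -dotpNl -dotpDl.
move: (p) pp => {h1} q pp.
have -> : l * (dotp (- (l^-1 *: q)) (- (l^-1 *: q)) / 2) = dotp q q / 2 / l.
  by rewrite !dotp_lin; field; rewrite gt_eqF.
have {}pp : l^-1 * dotp gx q - l^-1 * dotp gy q = dotp q q / l.
  by rewrite -mulrBr pp mulrC.
rewrite !dotp_lin; move: pp; move: (l^-1) (dotp q q) => k s.
move: (dotp gx q) (dotp gy q) (dotp gy x) (dotp gy y) => A B C E.
by clear=> pp h; lra.
Qed.

(** As [L 1] is finite, the smoothness inequality with [delta = 1] bounds [f] above everywhere. *)
Lemma inexactly_smooth_fin_num d (f : 'rV[R]_d -> \bar R) x g y :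
  inexactly_smooth L f -> subgradient f x g -> f y \is a fin_num.
Proof.
move=> [_ _ [fNy _] fsm] hg; have := fsm x y g 1 hg ler01.
have [/fineK <- _] := hg; have := fNy y.
by rewrite (isf_EFin hL ltr01) -EFinM -!EFinD; case: (f y).
Qed.

Lemma p_true_le_interp N d D (W : 'M[R]_N) :
  (p_true d D W L <= p_interp d D W L)%E.
Proof.
apply: ge_ereal_sup => _ [f [xs [x [g [[fsm fmin xD fg xit] ->]]]]].
have [_ fcvx [fNy [y0 fy0]] _] := fsm.
have sub0 : subgradient f xs 0.
  split=> [|z]; last by rewrite dotp0l adde0.
  by rewrite fin_numElt fNy (le_lt_trans (fmin y0)).
have ffin y : f y \is a fin_num by exact: inexactly_smooth_fin_num fsm sub0.
have [F fE] : exists F, forall y, f y = (F y)%:E.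
  by exists (fun y => fine (f y)) => y; rewrite fineK.
have [y z t t01|gN hgN] := convex_subgradient (f := F) (x ord_max).
  by have := fcvx y z t I I t01; rewrite !fE -!EFinM -EFinD lee_fin.
(* Only the last subgradient is replaced; the iterates do not involve it. *)
pose g' i := if i == ord_max then gN else g i.
have g'E (i : 'I_N.+1) : (i < N)%N -> g' i = g i.
  by move=> iN; rewrite /g' ifN// -val_eqE/= ltn_eqF.
have sub i : subgradient f (x i) (g' i).
  have [iN|] := ltnP i N; first by rewrite g'E//; exact: fg.
  move=> Ni; have -> : i = ord_max.
    by apply/val_inj/eqP; rewrite eqn_leq Ni -ltnS ltn_ord.
  by rewrite /g' eqxx; split=> // z; rewrite !fE -EFinD lee_fin; exact: hgN.
pose X i := if i is Some k then x k else xs.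
pose G i := if i is Some k then g' k else 0.
have subX i : subgradient f (X i) (G i) by case: i => [k|]; [exact: sub|].
apply: ereal_sup_ubound.
exists X, (fun i => F (X i)), G; split; last by rewrite !fE.
split=> //.
- move=> n; rewrite [LHS]xit /iterate; case: unlift => // m.
  congr (_ - _); apply: eq_bigr => i _; congr (_ *: _).
  by rewrite /G g'E//= ltn_ord.
- by rewrite subr_ge0.
- move=> i j; rewrite /Q_interp.
  have := inexactly_smooth_interp fsm (subX i) (subX j).
  rewrite !fE; case: theta_conj => [q| |]//; last by move=> _; exact: leey.
  by rewrite -EFinB !lee_fin subr_ge0.
Qed.

End UpperBound.

(** * Gram matrices *)

Section BilinearForm.
Context {R : realType}.

Lemma bformE n (G : 'M[R]_n) u v :
  bform G u v = \sum_i \sum_j G i j * (u i 0 * v j 0).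
Proof.
rewrite /bform -mulmxA mxE; apply: eq_bigr => i _.
rewrite !mxE mulr_sumr; apply: eq_bigr => j _; ring.
Qed.

Lemma bform_linear n a b (G G' : 'M[R]_n) u v :
  bform (a *: G + b *: G') u v = a * bform G u v + b * bform G' u v.
Proof.
by rewrite /bform mulmxDr mulmxDl -!scalemxAr -!scalemxAl 3!mxE [X in _ + X]mxE.
Qed.

Lemma bform_gram n d (M : 'M[R]_(n, d)) u v :
  bform (M *m M^T) u v = dotp (u^T *m M) (v^T *m M).
Proof. by rewrite /bform /dotp trmx_mul trmxK !mulmxA. Qed.

Lemma bform_le n (G : 'M[R]_n) v :
  bform G v v <= (\sum_i \sum_j `|G i j|) * dotp v^T v^T.
Proof.
rewrite bformE mulr_suml; apply: ler_sum => i _.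
rewrite mulr_suml; apply: ler_sum => j _.
apply: (@le_trans _ _ (`|G i j| * `|v i 0 * v j 0|)).
  by rewrite -normrM ler_norm.
apply: ler_wpM2l => //.
have sq k : v k 0 ^+ 2 <= dotp v^T v^T.
  rewrite dotpE (bigD1 k)//= !mxE -expr2 lerDl sumr_ge0// => k' _.
  by rewrite -expr2 sqr_ge0.
have := sq i; have := sq j; rewrite ler_norml => *.
have := sqr_ge0 (v i 0 - v j 0); have := sqr_ge0 (v i 0 + v j 0).
by move=> *; apply/andP; split; nra.
Qed.

(** Cholesky factorization: the first row and column are eliminated and the induction continues with
    the Schur complement. *)
Lemma psd_factor n (G : 'M[R]_n) : psd G -> exists M : 'M[R]_n, G = M *m M^T.
Proof.
elim: n G => [|n IH] G [Gsym Gpsd].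
  by exists 0; apply/matrixP => -[].
change 'M[R]_(1 + n) in G; change (G^T = G) in Gsym.
change (forall v : 'cV[R]_(1 + n), 0 <= bform G v v) in Gpsd.
pose b := dlsubmx G; pose C := drsubmx G.
have GE : G = block_mx (G 0 0)%:M b^T b C.
  have -> : (G 0 0)%:M = ulsubmx G.
    by rewrite [RHS]mx11_scalar !mxE; congr (G _ _)%:M; apply/val_inj.
  have -> : b^T = ursubmx G by rewrite /b -[in LHS]Gsym trmx_dlsub trmxK.
  by rewrite submxK.
have Csym : C^T = C by rewrite /C trmx_drsub Gsym.
have form t (w : 'cV[R]_n) : 0 <= G 0 0 * t ^+ 2 + 2 * t * (w^T *m b) 0 0
    + bform C w w.
  have := Gpsd (col_mx (t%:M : 'M[R]_1) w).
  rewrite /bform {1}GE tr_col_mx tr_scalar_mx mul_row_block mul_row_col.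
  rewrite !mulmxDl [X in 0 <= X]mxE [X in X + _]mxE [X in _ + X]mxE.
  rewrite -/(bform C w w) -!mulmxA !mul_scalar_mx !mul_mx_scalar.
  have -> : (t *: (b^T *m w)) 0 0 = t * (w^T *m b) 0 0.
    by rewrite mxE -[w^T *m b]trmxK trmx_mul trmxK [in RHS]mxE.
  have -> : (w^T *m (t *: b)) 0 0 = t * (w^T *m b) 0 0.
    by rewrite -scalemxAr mxE.
  have -> : (t *: (G 0 0 *: t%:M) : 'M[R]_1) 0 0 = t * (G 0 0 * t).
    by rewrite !mxE eqxx mulr1n.
  by lra.
have a0 : 0 <= G 0 0 by have := form 1 0; rewrite trmx0 mul0mx /bform mulmx0 !mxE; lra.
pose r := Num.sqrt (G 0 0); have r2 : r ^+ 2 = G 0 0 by rewrite sqr_sqrtr.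
(* With a zero pivot the form is affine in [t]; the chosen [t] would give it the value -1 if [b i 0]
   were nonzero. *)
have b0 : r = 0 -> b = 0.
  move=> r0; have Ga : G 0 0 = 0 by rewrite -r2 r0 expr0n.
  apply/colP => i; rewrite [RHS]mxE.
  have [//|bi] := eqVneq (b i 0) 0; suff : false by [].
  pose w : 'cV[R]_n := delta_mx i 0.
  have wb : (w^T *m b) 0 0 = b i 0 by rewrite trmx_delta -rowE mxE.
  have := form (- (bform C w w + 1) / (2 * b i 0)) w; rewrite Ga wb.
  have -> : 2 * (- (bform C w w + 1) / (2 * b i 0)) * b i 0 = - (bform C w w + 1).
    by field.
  by lra.
pose c : 'cV[R]_n := r^-1 *: b.
have rc : r *: c = b.
  rewrite /c scalerA; have [r0|r0] := eqVneq r 0; last by rewrite divff// scale1r.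
  by rewrite (b0 r0) scaler0.
(* The form of the Schur complement is that of [G] minimized over the first coordinate. If [r = 0]
   then [c = 0] and it is that of [C]. *)
have [|M' hM'] := IH (C - c *m c^T).
  split; first by rewrite linearB/= trmx_mul trmxK Csym.
  move=> v; have -> : bform (C - c *m c^T) v v =
      bform C v v - (v^T *m c) 0 0 ^+ 2.
    have := bform_linear 1 (-1) C (c *m c^T) v v.
    rewrite scale1r scaleN1r => ->; rewrite bform_gram dotpE big_ord1 -expr2.
    by ring.
  have [r0|r0] := eqVneq r 0.
    have := form 0 v; rewrite /c (b0 r0) scaler0 mulmx0 [(0 : 'M[R]_1) 0 0]mxE.
    by rewrite expr0n/=; lra.
  have := form (- (v^T *m c) 0 0 / r) v.
  have -> : (v^T *m b) 0 0 = r * (v^T *m c) 0 0.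
    by rewrite -rc -scalemxAr mxE.
  rewrite -r2.
  have -> : r ^+ 2 * (- (v^T *m c) 0 0 / r) ^+ 2 +
    2 * (- (v^T *m c) 0 0 / r) * (r * (v^T *m c) 0 0) = - (v^T *m c) 0 0 ^+ 2.
    by field.
  by lra.
pose M1 : 'M[R]_(1 + n) := block_mx r%:M 0 c M'.
suff GM : G = M1 *m M1^T by exists M1.
rewrite /M1 {1}GE tr_block_mx mulmx_block !trmx0 !mul0mx !mulmx0 !addr0.
rewrite tr_scalar_mx mul_scalar_mx scale_scalar_mx -expr2 r2.
rewrite mul_scalar_mx mul_mx_scalar rc -hM' [c *m _ + _]addrC subrK.
by congr block_mx; rewrite -rc linearZ.
Qed.

Lemma psd_gram_wide n d (G : 'M[R]_n) : (n <= d)%N -> psd G ->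
  exists M : 'M[R]_(n, d), G = M *m M^T.
Proof.
move=> nd /psd_factor[M ->]; rewrite -(subnKC nd).
exists (row_mx M 0).
by rewrite tr_row_mx mul_row_col trmx0 mulmx0 addr0.
Qed.

Lemma gram_psd n d (M : 'M[R]_(n, d)) : psd (M *m M^T).
Proof.
by split=> [|v]; rewrite ?trmx_mul ?trmxK// bform_gram dotp_ge0.
Qed.

(** With [G = M *m M^T], the trace is the sum of the form of [Z] over the columns of [M]. *)
Lemma trace_psd_ge0 n (Z G : 'M[R]_n) : psd Z -> psd G -> 0 <= \tr (Z *m G).
Proof.
move=> [_ Zpsd] /psd_factor[M ->].
rewrite mulmxA mxtrace_mulC mulmxA /mxtrace; apply: sumr_ge0 => i _.
have := Zpsd (col i M); congr (0 <= _).
by rewrite /bform tr_col -!row_mul !mxE; apply: eq_bigr => j _; rewrite !mxE.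
Qed.

End BilinearForm.

Section GramReformulation.
Context {R : realType}.

(** Serves both to pass from Gram coordinates to vectors and to evaluate polynomials in the Slater
    construction. *)
Lemma iterate_linear N (W : 'M[R]_N) (U V : lmodType R) (p : U -> V) x g n :
  linear p -> p (iterate W x g n) = iterate W (p x) (p \o g) n.
Proof.
move=> plin; pose P : {linear U -> V} :=
  HB.pack p (GRing.isLinear.Build _ _ _ _ _ plin).
rewrite -[LHS]/(P _) /iterate; case: unlift => // m.
by rewrite linearB linear_sum; congr (_ - _); apply: eq_bigr => i _; rewrite linearZ.
Qed.

Lemma eq_iterate N (W : 'M[R]_N) (V : lmodType R) (x : V) g g' (n : 'I_N.+1) :
  (forall i : 'I_N.+1, (i < n)%N -> g i = g' i) ->
  iterate W x g n = iterate W x g' n.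
Proof.
rewrite /iterate; case: unliftP => // m -> gg'.
congr (_ - _); apply: eq_bigr => i im; congr (_ *: _); apply: gg'.
by rewrite /= ltnS.
Qed.

Context {N d : nat} (W : 'M[R]_N) (M : 'M[R]_(N.+2, d)).

(** [M] is the transpose of [P]: its rows are [x_0 - x_star, g_0, ..., g_N]. *)
Let Phi (u : 'cV[R]_N.+2) : 'rV[R]_d := u^T *m M.

Lemma Phi_delta k : Phi (delta_mx k 0) = row k M.
Proof. by rewrite /Phi trmx_delta -rowE. Qed.

Lemma Phi_linear : linear Phi.
Proof. by move=> a u v; rewrite /Phi linearP/= mulmxDl scalemxAl. Qed.

Lemma Phi_iterate n : Phi (iterate W (e_x R N) (@e_g R N) n) =
  iterate W (row ord0 M) (fun i => row (lift ord0 i) M) n.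
Proof.
rewrite (iterate_linear _ _ _ _ Phi_linear) /= Phi_delta.
by apply: eq_iterate => i _; rewrite /= Phi_delta.
Qed.

Lemma Q_gramE (K : R -> \bar R) F xs i j : (forall x, 0 <= x -> (0 < K x)%E) ->
  Q_gram W K F (M *m M^T) i j =
  Q_interp K (fun i => xs + Phi (xvec W i)) F (fun i => Phi (gvec R i)) i j.
Proof.
move=> K0; rewrite /Q_gram /Q_interp theta_conjE// sqr_enorm !bform_gram.
by rewrite [- (xs + _)]opprD addrACA subrr add0r -!mulmxBl -!linearB.
Qed.

End GramReformulation.

(** Points yield the Gram matrix of [x_0 - x_star] and the gradients. Conversely a factor of [G],
    padded with zero columns up to [d], yields points with [x_star = 0]. *)
Lemma p_interp_gram (R : realType) N d D (W : 'M[R]_N) (K : R -> \bar R) :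
  (N + 2 <= d)%N -> (forall x, 0 <= x -> (0 < K x)%E) ->
  p_interp d D W K = p_gram D W K.
Proof.
move=> Nd K0; apply/eqP; rewrite eq_le; apply/andP; split.
  apply: ge_ereal_sup => _ [x [f [g [[xit g0 xD Q0] ->]]]].
  pose M : 'M[R]_(N.+2, d) := \matrix_k
    if unlift ord0 k is Some i then g (Some i) else x (Some ord0) - x None.
  have Mg i : row (lift ord0 i) M = g (Some i) by rewrite rowK liftK.
  have Mx : row ord0 M = x (Some ord0) - x None by rewrite rowK unlift_none.
  have PhiG i : (gvec R i)^T *m M = g i.
    by case: i => [i|]; rewrite /gvec ?Phi_delta ?Mg// trmx0 mul0mx g0.
  have PhiX i : x None + (xvec W i)^T *m M = x i.
    case: i => [i|]; last by rewrite /xvec trmx0 mul0mx addr0.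
    rewrite /xvec Phi_iterate Mx [RHS]xit /iterate; case: unlift => [m|].
      rewrite addrA [x None + _]addrC subrK; congr (_ - _).
      by apply: eq_bigr => k _; rewrite Mg.
    by rewrite addrC subrK.
  apply: ereal_sup_ubound; exists f, (M *m M^T); split=> //; split.
  - by rewrite /D_gram bform_gram /e_x Phi_delta Mx -sqr_enorm.
  - move=> i j; rewrite (Q_gramE _ _ _ (x None))//.
    have -> : (fun k => x None + (xvec W k)^T *m M) = x by apply/funext.
    have -> : (fun k => (gvec R k)^T *m M) = g by apply/funext.
    exact: Q0.
  - exact: gram_psd.
apply: ge_ereal_sup => _ [F [G [[GD Q0 Gpsd] ->]]].
have [|M GE] := psd_gram_wide _ Gpsd (d := d); first by rewrite -[N.+2]addn2.
rewrite {}GE in GD Q0 Gpsd *.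
apply: ereal_sup_ubound; exists (fun i => 0 + (xvec W i)^T *m M), F,
  (fun i => (gvec R i)^T *m M); split=> //; split.
- move=> n; rewrite !add0r /xvec !Phi_iterate.
  by rewrite [iterate _ _ _ ord0]/iterate unlift_none;
    apply: eq_iterate => i _; rewrite Phi_delta.
- by rewrite trmx0 mul0mx.
- move: GD; rewrite /D_gram bform_gram sqr_enorm !add0r trmx0 mul0mx subr0.
  by rewrite /xvec /iterate unlift_none.
- by move=> i j; rewrite -Q_gramE.
Qed.

(** * A Slater point *)

Section KrylovPolynomials.
Context {R : realType} {N : nat} (W : 'M[R]_N).

(** On a quadratic with Hessian [A], [G n] is the polynomial with [g_n = (G n)(A) (x_0 - x_star)].
    The recursion is well founded since [iterate] uses earlier indices only. *)
Lemma krylov_exists : exists G : 'I_N.+1 -> {poly R},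
  forall n, G n = 'X * iterate W 1 G n.
Proof.
suff h k : exists G : 'I_N.+1 -> {poly R},
    forall n : 'I_N.+1, (n < k)%N -> G n = 'X * iterate W 1 G n.
  by have [G hG] := h N.+1; exists G => n; exact: hG.
elim: k => [|k [G hG]]; first by exists (fun=> 0).
exists (fun n : 'I_N.+1 => if (n < k)%N then G n else 'X * iterate W 1 G n).
move=> n; rewrite ltnS => nk.
rewrite (@eq_iterate _ _ W _ 1 _ G) => [|i ni]; last first.
  by rewrite (leq_trans ni).
by case: ifP => // nk'; exact: hG.
Qed.

Hypothesis hdiag : forall i : 'I_N, W i i != 0.
Variable G : 'I_N.+1 -> {poly R}.
Hypothesis hG : forall n, G n = 'X * iterate W 1 G n.

(** [G n] has exact degree [n + 1]: for [n = m + 1] its leading coefficient is [- W m m] times that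
    of [G m]. *)
Lemma krylov_coef (n : 'I_N.+1) :
  (forall j, (n.+1 < j)%N -> (G n)`_j = 0) /\ (G n)`_n.+1 != 0.
Proof.
have [k nk] : exists k, (n < k)%N by exists n.+1.
elim: k => // k IH in n nk *; rewrite hG /iterate.
case: unliftP => [m nE|->]; last first.
  by split=> [[|[|j]] //|]; rewrite mulr1 coefX//= oner_neq0.
have nm : nat_of_ord n = m.+1 by rewrite nE lift0.
have IHm (i : 'I_N) : (i <= m)%N -> (widen_ord (leqnSn N) i < k)%N.
  by move=> im; rewrite /=; move: nk; rewrite nm ltnS; exact: leq_ltn_trans.
split=> [j nj|].
  rewrite coefXM; case: j nj => // j nj /=; rewrite coefB coef1 coef_sum.
  rewrite big1 => [|i im].
    by case: j nj => // j _; rewrite /= subr0.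
  rewrite coefZ (proj1 (IH _ (IHm _ im))) ?mulr0//=.
  by move: nj; rewrite nm !ltnS => nj; apply: leq_trans nj; rewrite ltnS.
rewrite coefXM nm /= coefB coef1 coef_sum/= sub0r oppr_eq0.
rewrite (bigD1 m)//= big1 => [|i /andP[im i_m]].
  by rewrite addr0 coefZ mulf_neq0// (proj2 (IH _ (IHm _ (leqnn m)))).
rewrite coefZ (proj1 (IH _ (IHm _ im))) ?mulr0//=.
by rewrite ltnS ltn_neqAle im andbT.
Qed.

Definition krylov_basis (k : 'I_N.+2) : {poly R} :=
  if unlift ord0 k is Some i then G i else 1.

Lemma krylov_basis_coef (k : 'I_N.+2) :
  (forall j, (k < j)%N -> (krylov_basis k)`_j = 0) /\ (krylov_basis k)`_k != 0.
Proof.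
rewrite /krylov_basis; case: unliftP => [i ->|->].
  by rewrite !lift0; exact: krylov_coef.
by split=> [[|j]//|]; rewrite coef1//= oner_neq0.
Qed.

(** Its rows are [x_0 = (1, ..., 1)] and the gradients of the method run on the quadratic with
    diagonal Hessian [h], minimized at 0. *)
Definition krylov_mx (h : 'I_N.+2 -> R) : 'M[R]_N.+2 :=
  \matrix_(k, r) (krylov_basis k).[h r].

(* The coefficient matrix of the basis is triangular, and evaluation at the
   points h is a Vandermonde matrix. *)
Lemma krylov_mx_unit h : injective h -> krylov_mx h \in unitmx.
Proof.
move=> hinj.
have -> : krylov_mx h = (\matrix_(k < N.+2, j < N.+2) (krylov_basis k)`_j)
    *m Vandermonde N.+2 (\row_r h r).
  apply/matrixP => k r; rewrite !mxE (@horner_coef_wide _ N.+2).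
    by apply: eq_bigr => j _; rewrite !mxE.
  apply/leq_sizeP => j kj; apply: (proj1 (krylov_basis_coef k)).
  exact: leq_trans (ltn_ord k) kj.
rewrite unitmx_mul; apply/andP; split; rewrite unitmxE unitfE.
  rewrite det_trig.
    by apply/prodf_neq0 => k _; rewrite mxE; exact: (krylov_basis_coef k).2.
  apply/is_trig_mxP => k j kj; rewrite mxE.
  exact: (krylov_basis_coef k).1.
rewrite det_Vandermonde; apply/prodf_neq0 => i _; apply/prodf_neq0 => j ij.
rewrite !mxE subr_eq0; apply/eqP => /hinj ji.
by rewrite ji ltnn in ij.
Qed.

Lemma krylov_grad h (i : star_index N) r :
  ((gvec R i)^T *m krylov_mx h) 0 r =
  h r * ((xvec W i)^T *m krylov_mx h) 0 r.
Proof.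
case: i => [i|]; last by rewrite /gvec /xvec trmx0 mul0mx mxE mulr0.
rewrite /gvec Phi_delta /xvec Phi_iterate !mxE /krylov_basis liftK hG hornerM hornerX.
congr (_ * _).
pose ev (p : {poly R}) : 'rV[R]_N.+2 := \row_r p.[h r].
have evlin : linear ev.
  by move=> a p q; apply/rowP => s; rewrite !mxE hornerD hornerZ.
have -> : (iterate W 1 G i).[h r] = ev (iterate W 1 G i) 0 r by rewrite mxE.
rewrite (iterate_linear _ _ _ _ evlin).
have -> : ev 1 = row ord0 (krylov_mx h).
  by apply/rowP => s; rewrite !mxE /krylov_basis unlift_none.
rewrite (@eq_iterate _ _ W _ _ _ (fun i => row (lift ord0 i) (krylov_mx h)))//.
by move=> k _; apply/rowP => s; rewrite !mxE /krylov_basis liftK.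
Qed.

End KrylovPolynomials.

(** [bform_le] bounds the norm of the inverse matrix; the [+ 1] keeps the bound positive. *)
Lemma unitmx_dotp_lb (R : realType) n (M : 'M[R]_n) : M \in unitmx ->
  exists2 c, 0 < c & forall v : 'cV_n,
    c * dotp v^T v^T <= dotp (v^T *m M) (v^T *m M).
Proof.
move=> Mu; set A := invmx M; pose B := \sum_i \sum_j `|(A *m A^T) i j| + 1.
have B0 : 0 < B by rewrite ltr_wpDl// sumr_ge0// => i _; rewrite sumr_ge0.
exists B^-1 => [|v]; first by rewrite invr_gt0.
rewrite ler_pdivrMl//.
have := bform_le (A *m A^T) (v^T *m M)^T.
rewrite bform_gram trmxK -mulmxA mulmxV// mulmx1 => h.
by apply: (le_trans h); rewrite ler_wpM2r ?dotp_ge0// lerDl.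
Qed.

Lemma pos_family_lb (R : realType) (T : finType) (P : pred T) (a : T -> R) :
  (forall t, P t -> 0 < a t) -> exists2 e, 0 < e & forall t, P t -> e <= a t.
Proof.
move=> a0; have S0 : 0 <= \sum_(t | P t) (a t)^-1.
  by apply: sumr_ge0 => t /a0 ?; rewrite invr_ge0 ltW.
exists (\sum_(t | P t) (a t)^-1 + 1)^-1 => [|t Pt].
  by rewrite invr_gt0 ltr_wpDl.
rewrite -[leRHS]invrK lef_pV2 ?posrE ?invr_gt0 ?a0 ?ltr_wpDl//.
rewrite (bigD1 t)//= -addrA lerDl addr_ge0// sumr_ge0// => k /andP[/a0 ? _].
by rewrite invr_ge0 ltW.
Qed.

Section Slater.
Context {R : realType} {N : nat} (D : R) (W : 'M[R]_N) (K : R -> \bar R) (H : R).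
Hypothesis D0 : 0 < D.
Hypothesis hdiag : forall i : 'I_N, W i i != 0.
Hypothesis K0 : forall x : R, 0 <= x -> (0 < K x)%E.
Hypothesis H0 : 0 < H.
Hypothesis KH : forall x : R, 0 <= x -> ((K x)^-1 <= (H * (1 + x))%:E)%E.

Lemma inve_fin_num (x : R) : 0 <= x -> (K x)^-1%E \is a fin_num.
Proof.
by move=> /K0; case: (K x) => [k| |]//; rewrite ?invey// lte_fin inver => /gt_eqF->.
Qed.

(** Unfolding the supremum gives constraints affine in [(F, G)], one for each [x], whence the
    concavity of [Q_gram]. *)
Lemma le_Q_gram s F G i j :
  (s%:E <= Q_gram W K F G i j)%E <-> forall x, 0 <= x ->
    bform G (gvec R i - gvec R j) (gvec R i - gvec R j) / 2 * fine (K x)^-1 - x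
    <= F i - F j - bform G (gvec R j) (xvec W i - xvec W j) - s.
Proof.
rewrite /Q_gram; set v := (X in (X%:E - _)%E); set u := bform _ _ _.
have -> : (s%:E <= v%:E - q_conj K u)%E = (q_conj K u <= (v - s)%:E)%E.
  case: q_conj => [q| |]; [|by rewrite leye_eq leeNy_eq|by rewrite !leNye leey].
  by rewrite -EFinB !lee_fin lerBrDl -lerBrDr.
have E (x : R) : 0 <= x -> ((u / 2)%:E / K x - x%:E)%E =
    (u / 2 * fine (K x)^-1 - x)%:E.
  by move=> /inve_fin_num/fineK {1}<-; rewrite -EFinM -EFinB.
split=> [h x x0|h].
  rewrite -lee_fin -E//; apply: le_trans h.
  by apply: ereal_sup_ubound; exists x => //=; rewrite in_itv/= x0.
apply: ge_ereal_sup => _ [x xP <-]; rewrite E ?lee_fin; last first.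
  by move: xP; rewrite /= in_itv/= andbT.
by apply: h; move: xP; rewrite /= in_itv/= andbT.
Qed.

(** Strictness is asked only for [i != j], because the diagonal constraints vanish identically. *)
Lemma slater_point : exists e F (G : 'M[R]_N.+2), [/\ 0 < e, G^T = G,
  e <= D_gram D G,
  (forall i j, i != j -> (e%:E <= Q_gram W K F G i j)%E) &
  forall v : 'cV_N.+2, e * dotp v^T v^T <= bform G v v].
Proof.
have [P hP] := krylov_exists W.
(* Curvatures at most [1 / (2 H)] make the part of [q_conj] at [x = 0] use at most half of the slack
   [S i j / 2]. *)
pose eta := (2 * H)^-1; have eta0 : 0 < eta by rewrite invr_gt0 mulr_gt0.
pose h (r : 'I_N.+2) : R := eta * (r.+1%:R / N.+2%:R).
have n0 : 0 < N.+2%:R :> R by rewrite ltr0n.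
have h0 r : 0 < h r by rewrite mulr_gt0 ?divr_gt0 ?ltr0n.
have heta r : h r <= eta.
  by rewrite /h ger_pMr// ler_pdivrMr// mul1r ler_nat ltn_ord.
have hinj : injective h.
  move=> r s /(mulfI (lt0r_neq0 eta0))/(mulIf (invr_neq0 (lt0r_neq0 n0)))/eqP.
  by rewrite eqr_nat eqSS => /eqP/val_inj.
pose M := krylov_mx P h; have Mu : M \in unitmx by exact: krylov_mx_unit.
have [y yE] : exists y, forall i, y i = (xvec W i)^T *m M.
  by exists (fun i => (xvec W i)^T *m M).
have [g gE] : exists g, forall i, g i = (gvec R i)^T *m M.
  by exists (fun i => (gvec R i)^T *m M).
have gy i r : g i 0 r = h r * y i 0 r by rewrite gE yE; exact: krylov_grad.
pose f i := \sum_r h r * y i 0 r ^+ 2 / 2.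
pose S i j := \sum_r h r * (y i 0 r - y j 0 r) ^+ 2.
have fS i j : f i - f j - dotp (g j) (y i - y j) = S i j / 2.
  rewrite /f /S dotpE -!sumrB mulr_suml; apply: eq_bigr => r _.
  by rewrite !mxE gy; move: (h r) => a; field.
pose u i j := dotp (g i - g j) (g i - g j).
have uS i j : u i j <= eta * S i j.
  rewrite /u dotpE mulr_sumr; apply: ler_sum => r _.
  have -> : (g i - g j) 0 r = h r * (y i 0 r - y j 0 r).
    by rewrite !mxE !gy mulrBr.
  have := heta r; have := h0 r; move: (h r) (y i 0 r - y j 0 r) => a b a0 ae.
  have -> : a * b * (a * b) = a * (a * b ^+ 2) by ring.
  by rewrite ler_wpM2r// mulr_ge0 ?sqr_ge0// ltW.
have u0 i j : 0 <= u i j by exact: dotp_ge0.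
have S0 i j : i != j -> 0 < S i j.
  move=> ij; rewrite -(pmulr_rgt0 _ eta0); apply: lt_le_trans (uS i j).
  rewrite lt_neqAle eq_sym u0 andbT dotp_eq0 subr_eq0.
  apply: contra ij => /eqP /(congr1 (mulmx^~ (invmx M))).
  rewrite /= !gE !mulmxK// => /trmx_inj; case: i j => [i|] [j|]//=.
  - move=> /matrixP/(_ (lift ord0 i) 0); rewrite !mxE !eqxx.
    case: eqP => [/lift_inj -> //|_ /eqP]; by rewrite oner_eq0.
  - move=> /matrixP/(_ (lift ord0 i) 0); rewrite !mxE !eqxx => /eqP.
    by rewrite oner_eq0.
  - move=> /matrixP/(_ (lift ord0 j) 0); rewrite !mxE !eqxx => /esym/eqP.
    by rewrite oner_eq0.
have [c c0 hc] := unitmx_dotp_lb Mu.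
pose d0 := dotp (row ord0 M) (row ord0 M); have d00 : 0 <= d0 by exact: dotp_ge0.
pose U := \sum_i \sum_j u i j.
have U0 : 0 <= U by apply: sumr_ge0 => i _; apply: sumr_ge0 => j _.
have uU i j : u i j <= U.
  rewrite /U (bigD1 i)//= (bigD1 j)//= -addrA lerDl addr_ge0//.
    by apply: sumr_ge0.
  by apply: sumr_ge0 => k _; apply: sumr_ge0.
(* Scaling by [t = T^-1] gives [t * u i j / 2 * H <= 1], so that [- x] absorbs the linear growth of
   [1 / K], and [t * d0 <= D ^+ 2 / 2]. *)
pose T := U * H / 2 + 2 * d0 / D ^+ 2 + 1.
have D2 : 0 < D ^+ 2 by rewrite exprn_gt0.
have T0 : 0 < T.
  by rewrite ltr_wpDl// addr_ge0 ?divr_ge0 ?mulr_ge0 ?sqr_ge0// ltW.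
pose t := T^-1; have t0 : 0 < t by rewrite invr_gt0.
have tT : t * T = 1 by rewrite mulVf ?gt_eqF.
have [e1 e10 he1] := @pos_family_lb R _ (fun p => p.1 != p.2)
  (fun p : star_index N * star_index N => t * S p.1 p.2 / 4)
  (fun p hp => ltac:(rewrite divr_gt0 ?mulr_gt0 ?S0//)).
pose e := Num.min e1 (Num.min (D ^+ 2 / 2) (t * c)).
have [e_e1 eD etc] : [/\ e <= e1, e <= D ^+ 2 / 2 & e <= t * c].
  by rewrite /e !ge_min !lexx !orbT.
exists e, (fun i => t * f i), (t *: (M *m M^T)).
have bE w z : bform (t *: (M *m M^T)) w z = t * dotp (w^T *m M) (z^T *m M).
  have := bform_linear t 0 (M *m M^T) 0 w z.
  by rewrite scale0r addr0 mul0r addr0 bform_gram.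
split.
- by rewrite !lt_min e10 divr_gt0// mulr_gt0.
- by rewrite linearZ/= trmx_mul trmxK.
- rewrite /D_gram bE /e_x Phi_delta -/d0.
  have : t * d0 <= D ^+ 2 / 2; last by lra.
  have : t * (2 * d0 / D ^+ 2) <= 1.
    rewrite -[leRHS]tT ler_pM2l// /T; have : 0 <= U * H / 2.
      by rewrite divr_ge0 ?mulr_ge0// ltW.
    by clear; lra.
  by rewrite !mulrA ler_pdivrMr//; lra.
- move=> i j ij; apply/le_Q_gram => x x0; rewrite !bE !linearB/= !mulmxBl.
  rewrite -!gE -!yE -/(u i j).
  have -> : t * f i - t * f j - t * dotp (g j) (y i - y j) = t * (S i j / 2).
    by rewrite -fS; ring.
  have := he1 (i, j) ij => /= eS.
  have k : fine (K x)^-1 <= H * (1 + x).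
    by rewrite -lee_fin fineK ?KH// inve_fin_num.
  have tu0 : 0 <= t * u i j / 2 by rewrite divr_ge0// mulr_ge0// ltW.
  have {}k := ler_wpM2l tu0 k.
  have tuH : t * u i j / 2 * H <= 1.
    rewrite -[leRHS]tT -!mulrA ler_pM2l// /T.
    have := ler_wpM2r (ltW H0) (uU i j).
    have : 0 <= 2 * d0 / D ^+ 2 by rewrite divr_ge0 ?mulr_ge0// ltW.
    by clear; lra.
  have tuS : t * u i j / 2 * H <= t * S i j / 4.
    have -> : t * S i j / 4 = t * (eta * S i j) / 2 * H.
      by rewrite /eta; field; rewrite gt_eqF.
    by rewrite ler_pM2r// ler_pM2r// ler_pM2l.
  have := ler_wpM2r x0 tuH; move: tuS k eS e_e1; clear.
  move: (fine _) (u i j) (S i j) => *; lra.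
- move=> v; rewrite bE; apply: (@le_trans _ _ (t * (c * dotp v^T v^T))).
    by rewrite mulrA ler_wpM2r ?dotp_ge0.
  by rewrite ler_pM2l.
Qed.

End Slater.

(** * Strong duality *)

Section Duality.
Context {R : realType} {N : nat} (D : R) (W : 'M[R]_N) (K : R -> \bar R).
Hypothesis K0 : forall x : R, 0 <= x -> (0 < K x)%E.

Lemma Q_gram_ltpinfty F G i j : (Q_gram W K F G i j < +oo)%E.
Proof.
rewrite ltey; apply/eqP => Qoo.
have h s := (le_Q_gram W K0 s F G i j).1; rewrite Qoo in h.
set u := bform G (gvec R i - gvec R j) (gvec R i - gvec R j) in h.
set v := F i - F j - _ in h.
have := h (v - u / 2 * fine (K 0)^-1 + 1) (leey _) 0 (lexx _).
by clear; lra.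
Qed.

Lemma Q_gram_fin_num F G i j :
  (0 <= Q_gram W K F G i j)%E -> Q_gram W K F G i j \is a fin_num.
Proof.
by move=> Q0; rewrite fin_numElt Q_gram_ltpinfty andbT (lt_le_trans _ Q0)// ltNy0.
Qed.

Lemma Q_gram_diag F G i : (0 <= Q_gram W K F G i i)%E.
Proof.
apply/(le_Q_gram W K0) => x x0; rewrite !subrr /bform !mulmx0 !mxE.
by rewrite mul0r mul0r sub0r !subr0 oppr_le0.
Qed.

Lemma lagrangianE nu lambda Z F G :
  (forall i j, Q_gram W K F G i j \is a fin_num) ->
  lagrangian D W K nu lambda Z F G =
  (F (Some ord_max) - F None + nu * D_gram D G +
   \sum_i \sum_j lambda i j * fine (Q_gram W K F G i j) + \tr (Z *m G))%:E.
Proof.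
move=> Qfin; rewrite /lagrangian !EFinD; congr (_ + _ + _ + _)%E.
rewrite -sumEFin; apply: eq_bigr => i _; rewrite -sumEFin; apply: eq_bigr => j _.
by rewrite EFinM fineK.
Qed.

Lemma weak_duality : (p_gram D W K <= d_gram D W K)%E.
Proof.
apply: ge_ereal_sup => _ [F [G [[GD Q0 Gpsd] ->]]].
apply: le_ereal_inf_tmp => _ [nu [lambda [Z [nu0 l0 Zpsd ->]]]].
have Qfin i j := Q_gram_fin_num (Q0 i j).
apply: (@le_trans _ _ (lagrangian D W K nu lambda Z F G)); last first.
  by apply: ereal_sup_ubound; exists F, G; split=> //; case: Gpsd.
rewrite lagrangianE// lee_fin.
have h1 := mulr_ge0 nu0 GD; have h2 := trace_psd_ge0 Zpsd Gpsd.
have h3 : 0 <= \sum_i \sum_j lambda i j * fine (Q_gram W K F G i j).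
  apply: sumr_ge0 => i _; apply: sumr_ge0 => j _.
  by rewrite mulr_ge0// fine_ge0.
by rewrite -[leLHS]addr0 -[leLHS]addr0 -[leLHS]addr0 !lerD.
Qed.

(* Index set of the perturbations: one for D, one for each Q_(i,j), and one for
   each entry of the matrix inequality. *)
Let T : finType :=
  (unit + (star_index N * star_index N + 'I_N.+2 * 'I_N.+2))%type.
Let iD : T := inl tt.
Let iQ i j : T := inr (inl (i, j)).
Let iZ a b : T := inr (inr (a, b)).

Let sum_T (c : T -> R) : \sum_t c t =
  c iD + (\sum_i \sum_j c (iQ i j) + \sum_a \sum_b c (iZ a b)).
Proof.
rewrite !big_sumType/= (big_pred1 tt) => [|[]//].
by rewrite !pair_bigA/=; congr (_ + (_ + _)); apply: eq_bigr => -[].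
Qed.

(** The epigraph of [p0] minus the value of the program with constraints tightened by [z]. The
    diagonal constraints have no slack and stay unperturbed. The matrix block of [z] may be
    nonsymmetric, as only its quadratic form counts. *)
Let epigraph (p0 : R) (z : T -> R) (r : R) := exists F (G : 'M[R]_N.+2),
  [/\ G^T = G, z iD <= D_gram D G,
    (forall i j, i != j -> ((z (iQ i j))%:E <= Q_gram W K F G i j)%E),
    (forall v, bform (\matrix_(a, b) z (iZ a b)) v v <= bform G v v) &
    p0 - (F (Some ord_max) - F None) <= r].

Let epigraph_convex p0 z z' r r' t : 0 < t < 1 ->
  epigraph p0 z r -> epigraph p0 z' r' ->
  epigraph p0 (fun i => t * z i + (1 - t) * z' i) (t * r + (1 - t) * r').
Proof.
move=> /andP[t0 t1] [F [G [Gs GD GQ GZ Gr]]] [F' [G' [Gs' GD' GQ' GZ' Gr']]].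
have t10 : 0 < 1 - t by lra.
exists (fun i => t * F i + (1 - t) * F' i), (t *: G + (1 - t) *: G'); split.
- by rewrite linearD !linearZ/= Gs Gs'.
- move: GD GD'; rewrite /D_gram bform_linear => h h'.
  have := ler_wpM2l (ltW t0) h; have := ler_wpM2l (ltW t10) h'.
  by move: (D ^+ 2); clear => q ? ?; lra.
- move=> i j ij; apply/(le_Q_gram W K0) => x x0; rewrite !bform_linear.
  have := (le_Q_gram W K0 _ _ _ _ _).1 (GQ i j ij) x x0.
  have := (le_Q_gram W K0 _ _ _ _ _).1 (GQ' i j ij) x x0.
  move=> /(ler_wpM2l (ltW t10)) + /(ler_wpM2l (ltW t0)); clear.
  move: (bform _ _ _) (bform _ _ _) (bform _ _ _) (bform _ _ _) => *; lra.
- move=> v; rewrite (_ : \matrix_(a, b) _ = t *: (\matrix_(a, b) z (iZ a b)) +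
      (1 - t) *: (\matrix_(a, b) z' (iZ a b))); last first.
    by apply/matrixP => a b; rewrite !mxE.
  rewrite !bform_linear.
  by apply: lerD; apply: ler_wpM2l => //; exact: ltW.
- have := ler_wpM2l (ltW t0) Gr; have := ler_wpM2l (ltW t10) Gr'; lra.
Qed.

Lemma big_norm_ge (I : finType) (z : I -> R) i : `|z i| <= \sum_j `|z j|.
Proof. by rewrite (bigD1 i)//= lerDl sumr_ge0. Qed.

Let epigraph_absorbing p0 e F (G : 'M[R]_N.+2) : 0 < e -> G^T = G ->
  e <= D_gram D G ->
  (forall i j, i != j -> (e%:E <= Q_gram W K F G i j)%E) ->
  (forall v : 'cV_N.+2, e * dotp v^T v^T <= bform G v v) ->
  forall z, exists t r, 0 < t /\ epigraph p0 (fun i => t * z i) r.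
Proof.
move=> e0 Gs GD GQ GZ z.
pose B := \sum_i `|z i|; have B0 : 0 <= B by apply: sumr_ge0.
have zB i : z i <= B by apply: le_trans (ler_norm _) (big_norm_ge z i).
pose t := e / (B + 1); have t0 : 0 < t by rewrite divr_gt0// ltr_wpDl.
have tB : t * B <= e.
  by rewrite mulrAC ler_pdivrMr ?ltr_wpDl// ler_pM2l// lerDl.
have tz i : t * z i <= e by apply: le_trans tB; rewrite ler_pM2l.
exists t, (p0 - (F (Some ord_max) - F None)); split=> //; exists F, G; split=> //.
- exact: le_trans GD.
- by move=> i j /GQ; apply: le_trans; rewrite lee_fin.
- move=> v; apply: le_trans (GZ v).
  apply: le_trans (bform_le _ _) _.
  apply: ler_wpM2r; first exact: dotp_ge0.
  apply: le_trans tB; rewrite /B mulr_sumr sum_T.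
  rewrite -[leLHS]add0r -[leLHS]add0r; apply: lerD.
    by rewrite mulr_ge0// ltW.
  apply: lerD.
    by do 2!(apply: sumr_ge0 => ? _); rewrite mulr_ge0// ltW.
  apply: ler_sum => a _; apply: ler_sum => b _.
  by rewrite mxE normrM gtr0_norm.
Qed.

Let epigraph_lower p0 z r : p_gram D W K = p0%:E ->
  (forall i, z i = 0) -> epigraph p0 z r -> 0 <= r.
Proof.
move=> pE z0 [F [G [Gs GD GQ GZ Gr]]]; apply: le_trans Gr.
rewrite subr_ge0 -lee_fin -pE; apply: ereal_sup_ubound; exists F, G; split=> //.
split=> [|i j|].
- by move: GD; rewrite z0.
- have [->|ij] := eqVneq i j; first exact: Q_gram_diag.
  by have := GQ i j ij; rewrite z0.
- split=> // v; apply: le_trans (GZ v); rewrite bformE.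
  apply: sumr_ge0 => a _; apply: sumr_ge0 => b _.
  by rewrite mxE z0 mul0r.
Qed.

(** Relaxing perturbations, however large, keep the Slater point admissible with one fixed value;
    this determines the signs of the multipliers. *)
Let lowered_epigraph p0 e F (G : 'M[R]_N.+2) z : 0 < e -> G^T = G ->
  e <= D_gram D G ->
  (forall i j, i != j -> (e%:E <= Q_gram W K F G i j)%E) ->
  (forall v : 'cV_N.+2, e * dotp v^T v^T <= bform G v v) ->
  z iD <= 0 -> (forall i j, z (iQ i j) <= 0) ->
  (forall v, bform (\matrix_(a, b) z (iZ a b)) v v <= 0) ->
  epigraph p0 z (p0 - (F (Some ord_max) - F None)).
Proof.
move=> e0 Gs GD GQ GZ zD zQ zZ; exists F, G; split=> //.
- by apply: le_trans zD _; apply: le_trans (ltW e0) GD.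
- move=> i j /GQ; apply: le_trans; rewrite lee_fin.
  exact: le_trans (zQ i j) (ltW e0).
- move=> v; apply: le_trans (zZ v) _; apply: le_trans (GZ v).
  by rewrite mulr_ge0 ?dotp_ge0// ltW.
Qed.

Lemma scaled_bounded_ge0 (x r : R) : (forall k, 0 <= k -> - k * x <= r) -> 0 <= x.
Proof.
move=> h; rewrite leNgt; apply/negP => x0.
have r0 : 0 <= r by have := h 0 (lexx _); rewrite oppr0 mul0r.
have := h ((r + 1) / - x) ltac:(by apply: divr_ge0; lra).
have -> : - ((r + 1) / - x) * x = r + 1 by field; rewrite lt_eqF.
by lra.
Qed.

Variable H : R.
Hypothesis D0 : 0 < D.
Hypothesis hdiag : forall i : 'I_N, W i i != 0.
Hypothesis H0 : 0 < H.
Hypothesis KH : forall x : R, 0 <= x -> ((K x)^-1 <= (H * (1 + x))%:E)%E.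

(** The supporting functional of the epigraph at 0 splits into [nu], [lambda] and a matrix [A],
    whose symmetric part is the multiplier [Z]. *)
Lemma dual_attained p0 : p_gram D W K = p0%:E -> (d_gram D W K <= p0%:E)%E.
Proof.
move=> pE.
have [e [F [G [e0 Gs GD GQ GZ]]]] := slater_point D0 hdiag K0 H0 KH.
pose rk (t : T) : 'I_#|T| := enum_rank t.
pose E (y : 'rV[R]_#|T|) r := epigraph p0 (fun t => y 0 (rk t)) r.
have [x y r s t t01 hx hy|r h|y|c hc] := @supporting_functional R _ E.
- have := epigraph_convex t01 hx hy; rewrite /E; congr epigraph.
  by apply/funext => i; rewrite !mxE.
- by apply: epigraph_lower pE _ h => i; rewrite mxE.
- have [t [r [t0 h]]] := epigraph_absorbing p0 e0 Gs GD GQ GZ (fun t => y 0 (rk t)).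
  exists t, r; split=> //; move: h; rewrite /E; congr epigraph.
  by apply/funext => i; rewrite mxE.
pose m t := c 0 (rk t).
have {}hc z r : epigraph p0 z r -> \sum_t m t * z t <= r.
  move=> h; have := hc (\row_i z (enum_val i)) r.
  have -> : E (\row_i z (enum_val i)) r = epigraph p0 z r.
    rewrite /E; congr epigraph; apply/funext => t.
    by rewrite mxE /rk enum_rankK.
  move=> /(_ h); congr (_ <= _); rewrite dotpE (reindex rk) /=; last first.
    exact/onW_bij/enum_rank_bij.
  by apply: eq_bigr => t _; rewrite mxE /rk enum_rankK.
have low z : z iD <= 0 -> (forall i j, z (iQ i j) <= 0) ->
    (forall v, bform (\matrix_(a, b) z (iZ a b)) v v <= 0) ->
    \sum_t m t * z t <= p0 - (F (Some ord_max) - F None).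
  by move=> zD zQ zZ; apply: hc; exact: (lowered_epigraph _ e0 Gs GD GQ GZ).
have mx0 v : bform (\matrix_(a < N.+2, b < N.+2) (0 : R)) v v = 0.
  rewrite bformE big1// => a _; rewrite big1// => b _.
  by rewrite mxE mul0r.
have m_ge0 (t1 : T) : (if t1 is inr (inr _) then False else True) -> 0 <= m t1.
  move=> ht1; apply: (@scaled_bounded_ge0 _ (p0 - (F (Some ord_max) - F None))).
  move=> k k0; have := low (fun t => if t == t1 then - k else 0).
  rewrite (bigD1 t1)//= eqxx big1 => [|t /negbTE->]; last by rewrite mulr0.
  rewrite addr0 mulrC; apply.
  - by case: eqP => // _; rewrite oppr_le0.
  - by move=> i j; case: eqP => // _; rewrite oppr_le0.
  - move=> v; rewrite (_ : \matrix_(a, b) _ = \matrix_(a, b) 0) ?mx0//.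
    by apply/matrixP => a b; rewrite !mxE; case: eqP ht1 => // <-.
pose A := \matrix_(a, b) m (iZ a b).
(* The matrix constraint is relaxed by [k *: (v *m v^T)], with [k] arbitrarily large. *)
have Aform (v : 'cV_N.+2) : 0 <= bform A v v.
  apply: (@scaled_bounded_ge0 _ (p0 - (F (Some ord_max) - F None))) => k k0.
  have := low (fun t => if t is inr (inr (a, b)) then - k * (v a 0 * v b 0) else 0).
  rewrite sum_T/= mulr0 add0r big1 => [|i _]; last first.
    by rewrite big1// => j _; rewrite mulr0.
  rewrite add0r.
  have -> : \sum_a \sum_b m (iZ a b) * (- k * (v a 0 * v b 0)) = - k * bform A v v.
    rewrite bformE mulr_sumr; apply: eq_bigr => a _.
    by rewrite mulr_sumr; apply: eq_bigr => b _; rewrite mxE; ring.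
  apply=> // w.
  have -> : \matrix_(a, b) (- k * (v a 0 * v b 0)) = 0 *: 0 + (- k) *: (v *m v^T).
    by apply/matrixP => a b; rewrite !mxE big_ord1 mxE mul0r add0r.
  by rewrite bform_linear mul0r add0r bform_gram mulNr oppr_le0 mulr_ge0 ?dotp_ge0.
pose Z := 2^-1 *: A + 2^-1 *: A^T.
have bformT v : bform A^T v v = bform A v v.
  rewrite !bformE exchange_big; apply: eq_bigr => a _; apply: eq_bigr => b _.
  by rewrite mxE [v b 0 * _]mulrC.
have Zpsd : psd Z.
  split=> [|v]; first by rewrite linearD !linearZ/= trmxK addrC.
  by rewrite bform_linear bformT; have := Aform v; lra.
apply: le_trans (ereal_inf_lbound _) _.
  exists (m iD), (fun i j => m (iQ i j)), Z; split; last by [].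
  - exact: m_ge0.
  - by move=> i j; exact: m_ge0.
  - exact: Zpsd.
apply: ge_ereal_sup => _ [F1 [G1 [G1s Qfin ->]]].
rewrite lagrangianE// lee_fin.
(* With [z] equal to the constraint values at [(F1, G1)], this pair is admissible for the perturbed
   program, and the supporting inequality says that the Lagrangian there is at most [p0]. *)
pose z (t : T) := match t with
  | inl _ => D_gram D G1
  | inr (inl (i, j)) => fine (Q_gram W K F1 G1 i j)
  | inr (inr (a, b)) => G1 a b end.
have : \sum_t m t * z t <= p0 - (F1 (Some ord_max) - F1 None).
  apply: hc; exists F1, G1; split=> //.
  - by move=> i j _; rewrite /= fineK.
  - move=> v; rewrite (_ : \matrix_(a, b) _ = G1)//.
    by apply/matrixP => a b; rewrite mxE.
rewrite sum_T /=.
have -> : \tr (Z *m G1) = \sum_a \sum_b m (iZ a b) * G1 a b.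
  have -> : \tr (Z *m G1) = \tr (A *m G1).
    rewrite mulmxDl -!scalemxAl linearD !linearZ/=.
    rewrite -[X in _ + _ * \tr (_ *m X)]G1s -trmx_mul mxtrace_tr mxtrace_mulC.
    by lra.
  rewrite /mxtrace; apply: eq_bigr => a _; rewrite mxE; apply: eq_bigr => b _.
  by rewrite mxE -[in LHS]G1s mxE.
by move: (\sum_i \sum_j _) (\sum_a \sum_b _) => *; lra.
Qed.

(** The Slater point excludes the value [-oo], and the value [+oo] makes the remaining inequality
    trivial. *)
Lemma strong_duality : p_gram D W K = d_gram D W K.
Proof.
apply/eqP; rewrite eq_le weak_duality/=.
have [e [F [G [e0 Gs GD GQ GZ]]]] := slater_point D0 hdiag K0 H0 KH.
have : ((F (Some ord_max) - F None)%:E <= p_gram D W K)%E.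
  apply: ereal_sup_ubound; exists F, G; split=> //; split.
  - exact: le_trans (ltW e0) GD.
  - move=> i j; have [->|ij] := eqVneq i j; first exact: Q_gram_diag.
    by apply: le_trans (GQ i j ij); rewrite lee_fin (ltW e0).
  - split=> // v; apply: le_trans (GZ v).
    by rewrite mulr_ge0 ?dotp_ge0// ltW.
case pE : (p_gram D W K) => [p0| |]//; last by move=> _; rewrite leey.
by move=> _; exact: dual_attained.
Qed.

End Duality.

(** * Linear growth of [1 / L] *)

Section GrowthBound.
Context {R : realType} (L : R -> \bar R).
Hypothesis hL : inexact_smoothness_function L.

Lemma isf_inve_le (x : R) : 0 <= x ->
  ((L x)^-1 <= ((fine (L 1))^-1 * (1 + x))%:E)%E.
Proof.
have K0 x := @isf_gt0 _ _ hL x; have l1 := isf_fine_gt0 hL ltr01.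
have v1 : (L 1)^-1%E = ((fine (L 1))^-1)%:E.
  by rewrite (isf_EFin hL ltr01)/= inver gt_eqF.
move=> x0; have [x1|x1] := leP x 1.
  apply: (@le_trans _ _ (L 1)^-1%E).
    rewrite lee_pV2 ?inE ?(ltW (K0 _ _))//; exact: (isf_noninc hL).
  by rewrite v1 lee_fin ler_peMr ?invr_ge0 ?(ltW l1)// lerDl.
have xgt0 : 0 < x by lra.
(* For [x > 1], the point 1 lies on the chord from 0 to [x] with weight [x^-1] at [x]; since
   [1 / L 0 >= 0], concavity gives [1 / L x <= x / L 1]. *)
have := isf_convexV hL (x := x) (y := 0) (t := x^-1).
rewrite /= !in_itv/= !andbT x0 lexx invr_ge0 x0 => /(_ isT isT).
rewrite invf_le1// (ltW x1) => /(_ isT).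
have -> : x^-1 *: (x : R^o) + (1 - x^-1) *: 0 = 1.
  by rewrite scaler0 addr0 -[LHS]/(x^-1 * x) mulVf ?gt_eqF.
rewrite v1.
have := inve_fin_num K0 x0; have := inve_fin_num K0 (lexx 0).
have : (0 <= (L 0)^-1)%E by rewrite inve_ge0 ltW// K0.
have : (0 <= (L x)^-1)%E by rewrite inve_ge0 ltW// K0.
case: ((L x)^-1)%E => [a| |]//; case: ((L 0)^-1)%E => [b| |]//.
rewrite -!EFinN -!EFinM -EFinD !lee_fin => a0 b0 _ _ h.
have p0 : 0 <= (1 - x^-1) * b.
  by rewrite mulr_ge0// subr_ge0 invf_le1// ltW.
have : x^-1 * a <= (fine (L 1))^-1 by move: p0 h; lra.
rewrite ler_pdivrMl// => {}h; apply: (le_trans h).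
by rewrite mulrC ler_pM2l ?invr_gt0// lerDr.
Qed.

Lemma self_scaled_inve_le : exists2 H, 0 < H & forall x : R, 0 <= x ->
  ((self_scaled L x)^-1 <= (H * (1 + x))%:E)%E.
Proof.
have c1 := self_smoothness_ge1 hL; set c := self_smoothness L in c1.
have c0 : 0 < c by lra.
have l1 := isf_fine_gt0 hL ltr01.
(* From [c / L (c * x) <= c * (1 + c * x) / L 1] and [1 + c * x <= (1 + c) * (1 + x)]. *)
exists (c * (1 + c) * (fine (L 1))^-1).
  by rewrite mulr_gt0 ?invr_gt0// mulr_gt0// addr_gt0.
move=> x x0; have cx0 : 0 <= c * x by rewrite mulr_ge0// ltW.
have := isf_inve_le cx0; have := isf_gt0 hL cx0; rewrite /self_scaled -/c.
rewrite [c%:E^-1%E]inver gt_eqF//; have k0 : 0 < (fine (L 1))^-1 by rewrite invr_gt0.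
move: (fine _)^-1 k0 => k k0; case: (L _) => [a| |]//.
  rewrite lte_fin => a0; rewrite -EFinM !inver !gt_eqF ?divr_gt0// !lee_fin => h.
  rewrite invfM invrK mulrC; apply: (@le_trans _ _ (c * (k * (1 + c * x)))).
    by rewrite ler_pM2l.
  have : 0 <= c * k * (c + x) by rewrite !mulr_ge0 ?addr_ge0// ltW.
  by lra.
move=> _ _; rewrite gt0_mulye ?lte_fin ?invr_gt0// invey lee_fin.
by rewrite !mulr_ge0 ?addr_ge0// ltW.
Qed.

End GrowthBound.

Local Close Scope classical_set_scope.

Theorem theorem3p6 (R : realType) (L : R -> \bar R)
    (hL : inexact_smoothness_function L)
    (N : nat) (hN : (1 <= N)%N) (D : R) (hD : 0 < D)
    (d : nat) (hd : (N + 2 <= d)%N)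
    (W : 'M[R]_N) (hW : is_trig_mx W) (hdiag : forall i : 'I_N, W i i != 0) :
  p_gram D W L = d_gram D W L /\
  (p_gram D W (self_scaled L) = d_gram D W (self_scaled L) /\
   d_gram D W (self_scaled L) = p_interp d D W (self_scaled L) /\
   (p_interp d D W (self_scaled L) <= p_true d D W L)%E /\
   (p_true d D W L <= p_interp d D W L)%E /\
   p_interp d D W L = p_gram D W L /\
   p_gram D W L = d_gram D W L).
Proof.
have L0 x : 0 <= x -> (0 < L x)%E by exact: isf_gt0.
have sL0 := self_scaled_gt0 hL.
have l1 : 0 < (fine (L 1))^-1 by rewrite invr_gt0 isf_fine_gt0.
have [H H0 KH] := self_scaled_inve_le hL.
have sd := strong_duality L0 hD hdiag l1 (isf_inve_le hL).
have sds := strong_duality sL0 hD hdiag H0 KH.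
split; [exact: sd|split; [exact: sds|split]].
  by rewrite -sds (p_interp_gram _ _ hd sL0).
split; last first.
  by split; [exact: p_true_le_interp|split; [exact: p_interp_gram|exact: sd]].
(* The interpolation argument uses unit vectors, hence a dimension of the form [n.+1]. *)
case: d hd => [|n _]; first by rewrite addn2.
exact: p_interp_self_scaled_le.
Qed.
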